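(* For $\mu>0$ let $\omega=\omega_\mu:\mathbb{R}\to\mathbb{R}$ be defined by $$\omega(\xi)=\sqrt{\frac{|\xi|\tanh(\sqrt{\mu}\,|\xi|)}{\sqrt{\mu}}}.$$ Then there exists a constant $C>0$, independent of $\mu$, such that for all $\mu>0$, all $t>0$ and all $\varphi\in\mathcal{S}(\mathbb{R})$, $$\big|e^{it\omega(D)}\varphi\big|_{L^\infty}\le C\left(\frac{1}{\mu^{1/4}}\frac{1}{(1+t/\sqrt{\mu})^{1/8}}+\frac{1}{(1+t/\sqrt{\mu})^{1/2}}\right)\big(|\varphi|_{H^1}+|x\partial_x\varphi|_{L^2}\big).$$
   Context: $\mathcal{S}(\mathbb{R})$ is the Schwartz space on $\mathbb{R}$. The operator $e^{it\omega(D)}$ is the Fourier multiplier defined by $\widehat{e^{it\omega(D)}\varphi}(\xi)=e^{it\omega(\xi)}\widehat{\varphi}(\xi)$. $|\cdot|_{H^1}$ is the usual norm of the Sobolev space $H^1(\mathbb{R})$, and $x\partial_x\varphi$ denotes the function $x\mapsto x\varphi'(x)$. *)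

(* Defs.v *)
From HB Require Import structures.
From mathcomp Require Import all_boot all_order all_algebra.
From mathcomp Require Import complex.
From mathcomp Require Import all_classical all_reals all_analysis.
Import Order.TTheory GRing.Theory Num.Theory.
Import numFieldNormedType.Exports.

Set Implicit Arguments.
Unset Strict Implicit.
Unset Printing Implicit Defensive.

Local Open Scope classical_set_scope.
Local Open Scope ring_scope.
Local Open Scope complex_scope.

Definition tanh (R : realType) (x : R) : R :=
  (expR x - expR (- x)) / (expR x + expR (- x)).

Definition omega (R : realType) (mu xi : R) : R :=
  Num.sqrt (`|xi| * tanh (Num.sqrt mu * `|xi|) / Num.sqrt mu).

Definition cexpi (R : realType) (theta : R) : R[i] :=
  cos theta +i* sin theta.

(* R[i] carries no normed-module structure over R in the library, so
   derivatives and integrals of R[i]-valued functions are componentwise. *)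
Definition cderive (R : realType) (f : R -> R[i]) : R -> R[i] :=
  fun x => ((fun y => complex.Re (f y))^`())%classic x
        +i* ((fun y => complex.Im (f y))^`())%classic x.

Definition cderivable (R : realType) (f : R -> R[i]) (x : R) : Prop :=
  derivable (fun y => complex.Re (f y)) x 1 /\ derivable (fun y => complex.Im (f y)) x 1.

Definition cderiven (R : realType) (n : nat) (f : R -> R[i]) : R -> R[i] :=
  iter n (@cderive R) f.

Definition cintegral (R : realType) (f : R -> R[i]) : R[i] :=
  (\int[lebesgue_measure]_x complex.Re (f x)) +i* (\int[lebesgue_measure]_x complex.Im (f x)).

(* The library norm on R[i] takes its values in R[i]; normc is the R-valued
   modulus. *)
Definition cmod (R : realType) (z : R[i]) : R := ComplexField.Normc.normc z.

Definition schwartz (R : realType) (f : R -> R[i]) : Prop :=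
  (forall (n : nat) (x : R), cderivable (cderiven n f) x) /\
  (forall k n : nat, exists M : R,
     forall x : R, `|x| ^+ k * cmod (cderiven n f x) <= M).

(* This normalization makes D = - i d/dx the multiplier of symbol xi. *)
Definition fourier (R : realType) (f : R -> R[i]) : R -> R[i] :=
  fun xi => cintegral (fun x => cexpi (- (x * xi)) * f x).

Definition inv_fourier (R : realType) (g : R -> R[i]) : R -> R[i] :=
  fun x => ((2 * pi)^-1)%:C * cintegral (fun xi => cexpi (x * xi) * g xi).

Definition fourier_mult (R : realType) (m f : R -> R[i]) : R -> R[i] :=
  inv_fourier (fun xi => m xi * fourier f xi).

Definition propagator (R : realType) (t : R) (w : R -> R) (f : R -> R[i]) :
    R -> R[i] :=
  fourier_mult (fun xi => cexpi (t * w xi)) f.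

Definition cLnorm (R : realType) (p : \bar R) (f : R -> R[i]) : \bar R :=
  Lnorm lebesgue_measure p (fun x => (cmod (f x))%:E).

(* For smooth (e.g. Schwartz) f only: the weak derivative of the H^1 norm is
   then the classical one. *)
Definition H1norm (R : realType) (f : R -> R[i]) : \bar R :=
  ((cLnorm 2%:E f ^+ 2 + cLnorm 2%:E (cderive f) ^+ 2) `^ 2^-1)%E.

(* Main.v *)
(** Put [s = t / sqrt mu]. Since the phase [omega] is even and
    [mu^(1/2) omega (xi) = g (mu^(1/2) xi)] with [g y = sqrt (y tanh y)], it
    suffices to bound integrals of [cos (x xi + t omega xi + th) u xi] over
    [xi > 0], where [u] is a real or imaginary part of the Fourier transform.
    A Bessel inequality (with a non-sharp constant, obtained from the Fejer
    kernel) gives [u], [xi u], [xi u'] in [L^2] with norms at most [N], the norm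
    of the right-hand side; hence [|u| <= 2 N min (xi^(-1/2), xi^(-1))].

    One computes [- g'' = K^2 / (4 g^3) + g S] with [S = 1 - tanh^2] and
    [K y = tanh y - y S y > 0], so [- g'' y >= c y] for [y <= 1] and
    [- g'' y >= c y^(-3/2)] for [y >= 1]. For [s >= 1] the half-line is cut at
    [s^(-1/4) mu^(-1/2)], [mu^(-1/2)] and [s]. The two extreme pieces are
    estimated by absolute values; on the two others one isolates the stationary
    point and integrates by parts away from it. Only the pieces below
    [mu^(-1/2)] produce the factor [mu^(-1/4) s^(-1/8)].

    All these one-dimensional estimates are comparisons of derivatives: a
    primitive of the integrand is compared with explicit functions and with
    primitives of [u^2], [(xi u)^2], [(xi u')^2]. *)

(* The obstacle is the weight: the data control [u'] only through [xi u'], so [u] may grow like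
   [xi^(-1/2)] near 0, and no van der Corput bound with an amplitude of bounded variation applies on
   the whole half-line, while [g''] degenerates at both ends. Hence the cuts. Below
   [s^(-1/4) mu^(-1/2)] Cauchy-Schwarz gives [N] times the square root of the length, which is the
   term [mu^(-1/4) s^(-1/8)]; above [s] the bound on [xi u] gives [N s^(-1/2)]. These two pieces fix
   the rates; the middle ones have to match them. Of Plancherel's theorem only an upper bound with
   some constant is needed: a triangle weight is inserted, whose transform is dominated by a
   multiple of a kernel of integral at most [pi] at every scale. Cauchy-Schwarz is used in the
   pointwise form [2 |a b| <= k a^2 + b^2 / k], with [k] chosen from [N], so that it can be an
   inequality between derivatives. *)
Require Import Defs.
From mathcomp Require Import all_boot all_order all_algebra.
From mathcomp Require Import complex.
From mathcomp Require Import all_classical all_reals all_analysis.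
From mathcomp Require Import measurable_realfun ess_sup_inf ring lra.
Import Order.TTheory GRing.Theory Num.Theory.
Import numFieldNormedType.Exports.

Local Open Scope ring_scope.
Local Open Scope complex_scope.

Set Implicit Arguments.
Unset Strict Implicit.
Unset Printing Implicit Defensive.

(** * Rules of differentiation and comparison of increments *)

Section Calculus.
Context {R : realType}.
Implicit Types (f g : R -> R) (x a b c : R).

Lemma derC c x : is_derive x 1 (fun=> c) 0.
Proof. exact: is_derive_cst. Qed.

Lemma derid x : is_derive x 1 (fun y : R => y) 1.
Proof. exact: is_derive_id. Qed.

Lemma derD f g x a b : is_derive x 1 f a -> is_derive x 1 g b ->
  is_derive x 1 (fun y => f y + g y) (a + b).
Proof. exact: is_deriveD. Qed.

Lemma derN f x a : is_derive x 1 f a -> is_derive x 1 (fun y => - f y) (- a).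
Proof. exact: is_deriveN. Qed.

Lemma derM f g x a b : is_derive x 1 f a -> is_derive x 1 g b ->
  is_derive x 1 (fun y => f y * g y) (a * g x + f x * b).
Proof.
move=> fa gb; apply: is_derive_eq (is_deriveM fa gb) _.
by rewrite /GRing.scale /=; ring.
Qed.

Lemma der_comp f g x a b : is_derive (g x) 1 f a -> is_derive x 1 g b ->
  is_derive x 1 (fun y => f (g y)) (a * b).
Proof. by move=> fa gb; exact: is_derive1_comp. Qed.

Lemma derX f n x a : is_derive x 1 f a ->
  is_derive x 1 (fun y => f y ^+ n) (n%:R * f x ^+ n.-1 * a).
Proof.
move=> fa; elim: n => [|n IH].
  by rewrite !mul0r; under eq_fun do rewrite expr0; exact: derC.
under eq_fun do rewrite exprS.
apply: is_derive_eq (derM fa IH) _.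
case: n {IH} => [|n]; rewrite /= ?exprS ?expr0; first by ring.
by rewrite -!natr1; ring.
Qed.

Lemma derV f x a : f x != 0 -> is_derive x 1 f a ->
  is_derive x 1 (fun y => (f y)^-1) (- (f x) ^- 2 * a).
Proof.
move=> fx0 [df fa]; apply: DeriveDef; first exact: derivableV.
by rewrite deriveV // fa.
Qed.

Lemma der_sin x : is_derive x 1 (@sin R) (cos x).
Proof. exact: is_derive_sin. Qed.
Lemma der_cos x : is_derive x 1 (@cos R) (- sin x).
Proof. exact: is_derive_cos. Qed.

Lemma der_expR x : is_derive x 1 (@expR R) (expR x).
Proof. exact: is_derive_expR. Qed.
Lemma der_sqrt x : 0 < x -> is_derive x 1 (@Num.sqrt R) (2 * Num.sqrt x)^-1.
Proof. exact: is_derive1_sqrt. Qed.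

Lemma eq_ler a b : a = b -> a <= b.
Proof. by move=> ->. Qed.

Lemma der_eq f x a b : is_derive x 1 f a -> a = b -> is_derive x 1 f b.
Proof. by move=> H <-. Qed.

(** Mean value theorem for [g - f]. With [f] a primitive of an integrand it plays the part of
    monotonicity of the integral, with no integrability to check. *)
Lemma ler_increment f df g dg a b : a <= b ->
  (forall x, a <= x <= b -> is_derive x 1 f (df x)) ->
  (forall x, a <= x <= b -> is_derive x 1 g (dg x)) ->
  (forall x, a <= x <= b -> df x <= dg x) ->
  f b - f a <= g b - g a.
Proof.
move=> ab Hf Hg fg.
have [x xab] : exists2 x, x \in `[a, b]%R &
    (fun y => g y - f y) b - (fun y => g y - f y) a = (dg x - df x) * (b - a).
  apply: (@MVT_segment _ (fun y => g y - f y) (fun y => dg y - df y)) => //.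
    move=> x /subset_itv_oo_cc; rewrite /= in_itv /= => xab.
    by apply: derD; [exact: Hg|apply: derN; exact: Hf].
  apply: derivable_within_continuous => x; rewrite in_itv /= => xab.
  by have [] : is_derive x 1 (fun y => g y - f y) (dg x - df x)
    by apply: derD; [exact: Hg|apply: derN; exact: Hf].
move=> /= E; rewrite -subr_ge0.
have -> : g b - g a - (f b - f a) = (dg x - df x) * (b - a) by rewrite -E; ring.
by rewrite mulr_ge0 // subr_ge0 //; apply: fg; move: xab; rewrite in_itv.
Qed.

Lemma ler_of_der_ge0 f df a b : a <= b ->
  (forall x, a <= x <= b -> is_derive x 1 f (df x)) ->
  (forall x, a <= x <= b -> 0 <= df x) -> f a <= f b.
Proof.
move=> ab Hf df0; have := ler_increment ab (fun x _ => derC 0 x) Hf df0.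
by rewrite subrr subr_ge0.
Qed.

Lemma ler_norm_increment f df g dg a b : a <= b ->
  (forall x, a <= x <= b -> is_derive x 1 f (df x)) ->
  (forall x, a <= x <= b -> is_derive x 1 g (dg x)) ->
  (forall x, a <= x <= b -> `|df x| <= dg x) ->
  `|f b - f a| <= g b - g a.
Proof.
move=> ab Hf Hg fg; rewrite ler_norml; apply/andP; split; last first.
  by apply: (ler_increment ab Hf Hg) => x /fg; exact/le_trans/ler_norm.
have : (- f b) - (- f a) <= g b - g a.
  apply: (@ler_increment (fun y => - f y) (fun y => - df y) g dg) => // x xab.
    exact/derN/Hf.
  by rewrite (le_trans _ (fg _ xab)) // -normrN ler_norm.
by lra.
Qed.

Lemma norm_cosM_le (y a : R) : `|cos y * a| <= `|a|.
Proof. by rewrite normrM ler_piMl // ler_norml cos_geN1 cos_le1. Qed.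

End Calculus.

(* [is_derive] is a class: without [notypeclasses], instance resolution fills
   the derivative with scaling-shaped terms that [ring] does not see through. *)
Ltac der_step := first
  [ eassumption
  | notypeclasses refine (derC _ _)
  | notypeclasses refine (derid _)
  | notypeclasses refine (derD _ _)
  | notypeclasses refine (derN _)
  | notypeclasses refine (derM _ _)
  | notypeclasses refine (derX _ _)
  | notypeclasses refine (derV _ _)
  | notypeclasses refine (der_comp (der_sin _) _)
  | notypeclasses refine (der_comp (der_cos _) _)
  | notypeclasses refine (der_comp (der_expR _) _) ].

Ltac der := eapply der_eq; [repeat der_step |].

(** * The dispersion relation *)

Section Dispersion.
Context {R : realType}.
Implicit Types (x y m : R).

Local Notation T := (@tanh R).
Local Notation S x := (1 - T x ^+ 2).

Lemma coshD_gt0 x : 0 < expR x + expR (- x) :> R.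
Proof. by rewrite addr_gt0 ?expR_gt0. Qed.

Lemma der_tanh x : is_derive x 1 T (S x).
Proof.
have c0 := lt0r_neq0 (coshD_gt0 x).
rewrite -[T]/(fun y : R => (expR y - expR (- y)) / (expR y + expR (- y))).
der => /=.
by rewrite /tanh /=; field.
Qed.

Lemma tanh0 : T 0 = 0.
Proof. by rewrite /tanh oppr0 subrr mul0r. Qed.

Lemma sech2_gt0 x : 0 < S x.
Proof.
have c0 := coshD_gt0 x; have c0' := lt0r_neq0 c0.
have -> : S x = 4 * (expR x * expR (- x)) / (expR x + expR (- x)) ^+ 2.
  by rewrite /tanh; field.
by rewrite divr_gt0 ?exprn_gt0 // mulr_gt0 ?mulr_gt0 ?expR_gt0.
Qed.

Lemma tanh_gt0 x : 0 < x -> 0 < T x.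
Proof.
by move=> x0; rewrite divr_gt0 ?coshD_gt0 // subr_gt0 ltr_expR; lra.
Qed.

Lemma tanh_le x y : x <= y -> T x <= T y.
Proof.
move=> xy; apply: (@ler_of_der_ge0 _ T (fun x => S x)) => // z _.
- exact: der_tanh.
- exact/ltW/sech2_gt0.
Qed.

Lemma tanh_lt1 x : T x < 1.
Proof.
rewrite ltr_pdivrMr ?coshD_gt0 // mul1r; have := expR_gt0 (- x : R); lra.
Qed.

Lemma tanh_ge0 x : 0 <= x -> 0 <= T x.
Proof. by move=> /tanh_le; rewrite tanh0. Qed.

Lemma sech2_le x y : 0 <= x -> x <= y -> S y <= S x.
Proof.
move=> x0 xy; rewrite lerD2l lerN2 ler_sqr ?nnegrE ?tanh_ge0 ?tanh_le //.
exact: le_trans xy.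
Qed.

Definition tanh_gap x : R := T x - x * S x.
Local Notation K := tanh_gap.

Lemma der_K x : is_derive x 1 K (2 * x * T x * S x).
Proof.
rewrite /tanh_gap.
eapply der_eq; first by repeat first [exact: der_tanh|der_step].
by rewrite /=; ring.
Qed.

Lemma K_le x y : 0 <= x -> x <= y -> K x <= K y.
Proof.
move=> x0 xy; apply: (@ler_of_der_ge0 _ K (fun x => 2 * x * T x * S x)) => // z.
  by move=> _; exact: der_K.
move=> /andP[xz _]; have z0 := le_trans x0 xz.
apply: mulr_ge0; last exact/ltW/sech2_gt0.
by apply: mulr_ge0; [exact: mulr_ge0|exact: tanh_ge0].
Qed.

Lemma tanh_gap0 : K 0 = 0.
Proof. by rewrite /tanh_gap tanh0 mul0r subrr. Qed.

(** Monotonicity of [K] only gives [K 1 >= 0]. Strictness comes from a positive lower bound [k] of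
    its derivative on [[1/2, 1]], where [2 x >= 1], [T x >= T (1/2)] and [S x >= S 1]. *)
Lemma K1_gt0 : 0 < K 1.
Proof.
have h0 : (0 : R) < 2^-1 by rewrite invr_gt0.
have h1 : (2^-1 : R) <= 1 by rewrite invf_le1 // ler1n.
have T0 : 0 < T 2^-1 by exact: tanh_gt0.
pose k := T 2^-1 * S 1; have k0 : 0 < k by rewrite mulr_gt0 ?sech2_gt0.
have : (fun y => k * y) 1 - (fun y => k * y) 2^-1 <= K 1 - K 2^-1.
  notypeclasses refine (@ler_increment _ (fun y => k * y) (fun=> k) K
    (fun x => 2 * x * T x * S x) _ _ h1 _ _ _) => x.
  - by move=> _; der; rewrite mul0r add0r mulr1.
  - by move=> _; exact: der_K.
  move=> /andP[hx x1]. 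
  have x0 : 0 <= x by exact: le_trans hx; exact: ltW.
  apply: ler_pM; [exact: ltW|exact/ltW/sech2_gt0| |exact: sech2_le].
rewrite -[leLHS]mul1r; apply: ler_pM; [by []|exact: ltW| |exact: tanh_le].
  by move: hx; lra.
have : K 0 <= K 2^-1 by rewrite K_le // ltW.
rewrite tanh_gap0 /=; move: k0 h0; lra.
Qed.


Definition disp x : R := Num.sqrt (x * T x).
Definition disp1 x : R := (T x + x * S x) / (2 * disp x).
Definition disp2 x : R := - (K x ^+ 2 / (4 * disp x ^+ 3) + disp x * S x).

Lemma disp_gt0 x : 0 < x -> 0 < disp x.
Proof. by move=> x0; rewrite sqrtr_gt0 mulr_gt0 ?tanh_gt0. Qed.

Lemma sqr_disp x : 0 < x -> disp x ^+ 2 = x * T x.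
Proof. by move=> x0; rewrite sqr_sqrtr // mulr_ge0 ?tanh_ge0 ?ltW. Qed.

Lemma der_disp x : 0 < x -> is_derive x 1 disp (disp1 x).
Proof.
move=> x0; rewrite /disp; eapply der_eq.
  notypeclasses refine (der_comp (der_sqrt _) _).
    by rewrite mulr_gt0 ?tanh_gt0.
  by repeat first [exact: der_tanh|der_step].
by rewrite /= /disp1 -/(disp x) mul1r mulrC.
Qed.

Lemma der_disp1 x : 0 < x -> is_derive x 1 disp1 (disp2 x).
Proof.
move=> x0; have d0 := lt0r_neq0 (disp_gt0 x0).
rewrite /disp1; eapply der_eq.
  repeat first [exact: der_tanh|exact: der_disp|der_step].
  by rewrite mulf_neq0 ?pnatr_eq0.
rewrite /= /disp2 /disp1.
have E := sqr_disp x0.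
apply/eqP; rewrite -subr_eq0.
set d := disp x in d0 E *; rewrite /tanh_gap; set a := T x in E *.
have z0 : d ^+ 2 - x * a = 0 by rewrite E subrr.
(* The two expressions agree only modulo [d ^+ 2 = x * a]; their difference is this explicit
   multiple of the relation. *)
apply/eqP; transitivity ((d ^+ 2 - x * a) * (1 - a ^+ 2) * (1 + d ^+ 2) / d ^+ 3).
  by field.
by rewrite z0 !mul0r.
Qed.

(** Both terms of [- disp2] are nonnegative, and each range keeps one. On [(0, 1]] it is
    [disp x * S x]: there [K x >= 0] means [T x >= x * S x], hence [disp x >= S 1 * x]. For [x >= 1]
    it is the quotient, with [K x >= K 1] and [disp x <= sqrt x]. *)
Lemma disp2_bounds : exists2 c : R, 0 < c &
  (forall x, 0 < x -> x <= 1 -> disp2 x <= - (c * x)) /\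
  (forall x, 1 <= x -> disp2 x <= - (c / (x * Num.sqrt x))).
Proof.
have S0 := sech2_gt0 1; have K0 := K1_gt0.
have S1 : S 1 <= 1 by rewrite gerBl sqr_ge0.
pose c := Num.min (S 1 ^+ 2) (K 1 ^+ 2 / 4).
exists c; first by rewrite lt_min exprn_gt0 // divr_gt0 // exprn_gt0.
have d3 x : 0 < x -> 0 < 4 * disp x ^+ 3.
  by move=> x0; rewrite mulr_gt0 // exprn_gt0 // disp_gt0.
split => [x x0 x1|x x1].
  have x0' := ltW x0.
  rewrite /disp2 lerN2; apply: (@le_trans _ _ (disp x * S x)); last first.
    by rewrite lerDr divr_ge0 ?sqr_ge0 // ltW // d3.
  apply: (@le_trans _ _ (S 1 ^+ 2 * x)).
    by rewrite ler_pM2r // ge_min lexx.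
  rewrite expr2 -mulrA mulrC; apply: ler_pM; rewrite ?mulr_ge0 ?(ltW S0) //.
    rewrite -ler_sqr ?nnegrE ?mulr_ge0 ?(ltW S0) ?(ltW (disp_gt0 x0)) //.
    have Kx : 0 <= K x by rewrite -tanh_gap0 K_le.
    rewrite sqr_disp // exprMn.
    apply: (@le_trans _ _ (x * (x * S x))); last first.
      by rewrite ler_pM2l // -subr_ge0.
    have -> : S 1 ^+ 2 * x ^+ 2 = x * (x * (S 1 * S 1)) by ring.
    rewrite ler_pM2l // ler_pM2l //; apply: (le_trans _ (sech2_le x0' x1)).
    by apply: ler_piMr S1; exact: ltW.
  exact: sech2_le.
have x0 : 0 < x by exact: lt_le_trans x1.
have sx : 0 < Num.sqrt x by rewrite sqrtr_gt0.
rewrite /disp2 lerN2.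
apply: (@le_trans _ _ (K x ^+ 2 / (4 * disp x ^+ 3))); last first.
  by rewrite lerDl mulr_ge0 ?(ltW (disp_gt0 x0)) // ltW // sech2_gt0.
have dx : disp x <= Num.sqrt x.
  by apply: ler_wsqrtr; apply: ler_piMr; rewrite ltW // tanh_lt1.
have xx : 0 < x * Num.sqrt x by rewrite mulr_gt0.
apply: (@le_trans _ _ (K 1 ^+ 2 / 4 / (x * Num.sqrt x))).
  by rewrite ler_pM2r ?invr_gt0 // ge_min lexx orbT.
rewrite -mulrA -invfM; apply: ler_pM; rewrite ?sqr_ge0 ?invr_ge0 //.
- by rewrite mulr_ge0 // ltW.
- have K1x : K 1 <= K x by exact: K_le.
  by rewrite ler_sqr ?nnegrE ?(ltW K0) // (le_trans (ltW K0)).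
- rewrite lef_pV2 ?posrE ?d3 ?mulr_gt0 // ler_pM2l //.
  have -> : x * Num.sqrt x = Num.sqrt x ^+ 3.
    by rewrite exprSr sqr_sqrtr // ltW.
  by apply: lerXn2r => //; rewrite nnegrE ltW // disp_gt0.
Qed.

End Dispersion.

(** * Oscillatory integrals on a half-line *)

Section Oscillation.
Context {R : realType}.
Variables (N : R) (u du P1 P2 P3 : R -> R).
Hypothesis N0 : 0 < N.
Hypothesis der_u : forall x : R, is_derive x 1 u (du x).
Hypothesis der_P1 : forall x : R, is_derive x 1 P1 (u x ^+ 2).
Hypothesis der_P2 : forall x : R, is_derive x 1 P2 ((x * u x) ^+ 2).
Hypothesis der_P3 : forall x : R, is_derive x 1 P3 ((x * du x) ^+ 2).
Hypothesis P1_le : forall a b : R, 0 <= a -> a <= b -> P1 b - P1 a <= N ^+ 2.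
Hypothesis P2_le : forall a b : R, 0 <= a -> a <= b -> P2 b - P2 a <= N ^+ 2.
Hypothesis P3_le : forall a b : R, 0 <= a -> a <= b -> P3 b - P3 a <= N ^+ 2.

Lemma norm_le_of_sqr (a b : R) : 0 <= b -> a ^+ 2 <= b ^+ 2 -> `|a| <= b.
Proof. by move=> b0; rewrite -[a ^+ 2](real_normK (num_real a)) ler_sqr ?nnegrE. Qed.

(** Pointwise Cauchy-Schwarz for [|a| = |x a| * x^-1]. The free parameter [k] is later chosen so
    that the two terms, once integrated, are equal. *)
Lemma amgm_weight (a k x : R) : 0 < k -> 0 < x ->
  `|a| <= k / 2 * (x * a) ^+ 2 + (2 * k)^-1 * (x ^+ 2)^-1.
Proof.
move=> k0 x0; rewrite -subr_ge0.
have -> : k / 2 * (x * a) ^+ 2 + (2 * k)^-1 * (x ^+ 2)^-1 - `|a| =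
   (k * x ^+ 2 * `|a| - 1) ^+ 2 / (2 * k * x ^+ 2).
  rewrite exprMn -[a ^+ 2](real_normK (num_real a)); field.
  by rewrite !lt0r_neq0.
apply: divr_ge0; first exact: sqr_ge0.
by apply: mulr_ge0; [apply: mulr_ge0 => //; exact: ltW|exact: sqr_ge0].
Qed.

(* [x u^2] and [(x u)^2] vanish at 0, and their derivatives are controlled by
   the three energies through AM-GM. *)
Lemma amp_le_sqrt (q x : R) : 0 < q -> q ^+ 2 <= x -> `|u x| <= 2 * N / q.
Proof.
move=> q0 qx; have x0 : 0 <= x by apply: le_trans qx; exact: sqr_ge0.
have : x * u x ^+ 2 - 0 * u 0 ^+ 2 <=
       (2 * P1 x + P3 x) - (2 * P1 0 + P3 0).
  notypeclasses refine (@ler_increment _ (fun x => x * u x ^+ 2)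
    (fun x => u x ^+ 2 + 2 * x * u x * du x)
    (fun x => 2 * P1 x + P3 x) (fun x => 2 * u x ^+ 2 + (x * du x) ^+ 2)
    _ _ x0 _ _ _) => y _.
  - by have Hu := der_u y; der; rewrite /=; ring.
  - have H1 := der_P1 y; have H3 := der_P3 y.
    by der; rewrite mul0r add0r.
  - rewrite -subr_ge0.
    have -> : 2 * u y ^+ 2 + (y * du y) ^+ 2 - (u y ^+ 2 + 2 * y * u y * du y) =
      (u y - y * du y) ^+ 2 by ring.
    exact: sqr_ge0.
have := P1_le (lexx 0) x0; have := P3_le (lexx 0) x0.
move=> h3 h1 h; apply: norm_le_of_sqr.
  by rewrite divr_ge0 // ?mulr_ge0 // ltW.
rewrite exprMn exprVn ler_pdivlMr ?exprn_gt0 //.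
apply: (@le_trans _ _ (u x ^+ 2 * x)); first by rewrite ler_wpM2l ?sqr_ge0.
have := sqr_ge0 N; move: h h1 h3; rewrite exprMn; lra.
Qed.

Lemma amp_le (p x : R) : 0 < p -> p <= x -> `|u x| <= 2 * N / p.
Proof.
move=> p0 px; have x0 : 0 < x by exact: lt_le_trans px.
have : (x * u x) ^+ 2 - (0 * u 0) ^+ 2 <=
       (P1 x + 2 * P2 x + P3 x) - (P1 0 + 2 * P2 0 + P3 0).
  notypeclasses refine (@ler_increment _ (fun x => (x * u x) ^+ 2)
    (fun x => 2 * (x * u x) * (u x + x * du x))
    (fun x => P1 x + 2 * P2 x + P3 x)
    (fun x => u x ^+ 2 + 2 * (x * u x) ^+ 2 + (x * du x) ^+ 2)
    _ _ (ltW x0) _ _ _) => y _.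
  - by have := der_u y => Hu; der; rewrite /=; ring.
  - have H1 := der_P1 y; have H2 := der_P2 y; have H3 := der_P3 y.
    by der; rewrite mul0r add0r.
  - rewrite -subr_ge0.
    have -> : u y ^+ 2 + 2 * (y * u y) ^+ 2 + (y * du y) ^+ 2 -
      2 * (y * u y) * (u y + y * du y) =
      (u y - y * u y) ^+ 2 + (y * u y - y * du y) ^+ 2 by ring.
    by rewrite addr_ge0 // sqr_ge0.
have := P1_le (lexx 0) (ltW x0); have := P2_le (lexx 0) (ltW x0).
have := P3_le (lexx 0) (ltW x0).
move=> h3 h2 h1 h; apply: norm_le_of_sqr.
  by rewrite divr_ge0 // ?mulr_ge0 // ltW.
rewrite exprMn exprVn ler_pdivlMr ?exprn_gt0 //.
apply: (@le_trans _ _ ((x * u x) ^+ 2)).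
  rewrite [leRHS]exprMn mulrC ler_wpM2r ?sqr_ge0 //.
  by apply: lerXn2r; rewrite ?nnegrE // ltW.
move: h h1 h2 h3; rewrite mul0r expr0n /= exprMn; lra.
Qed.

(** * Increments of a primitive of [cos psi * u] for a general phase *)

Section Phase.
Variables (H psi : R -> R).
Hypothesis der_H : forall x : R, is_derive x 1 H (cos (psi x) * u x).

(** Cauchy-Schwarz for [|u|] against 1 on [[0, b]], oscillation ignored. The weight [e / N] makes
    each of the two terms [N * e / 2]. *)
Lemma increment_near0 (e b : R) : 0 < e -> 0 <= b -> b <= e ^+ 2 ->
  `|H b - H 0| <= N * e.
Proof.
move=> e0 b0 be.
have k0 : 0 < e / N by rewrite divr_gt0.
have : `|H b - H 0| <= ((e / N) / 2 * P1 b + (2 * (e / N))^-1 * b) -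
   ((e / N) / 2 * P1 0 + (2 * (e / N))^-1 * 0).
  notypeclasses refine (@ler_norm_increment _ H _
    (fun x => (e / N) / 2 * P1 x + (2 * (e / N))^-1 * x)
    (fun x => (e / N) / 2 * u x ^+ 2 + (2 * (e / N))^-1) _ _ b0
    (fun x _ => der_H x) _ _) => y _.
  - by have H1 := der_P1 y; der; rewrite /=; ring.
  - apply: (le_trans (norm_cosM_le _ _)).
    by have := amgm_weight (u y) k0 ltr01; rewrite mul1r expr1n invr1 mulr1.
move=> /le_trans; apply; rewrite mulr0 addr0.
have -> : e / N / 2 * P1 b + (2 * (e / N))^-1 * b - e / N / 2 * P1 0 =
  e / N / 2 * (P1 b - P1 0) + (2 * (e / N))^-1 * b by ring.
apply: (@le_trans _ _ (e / N / 2 * N ^+ 2 + (2 * (e / N))^-1 * e ^+ 2)).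
  apply: lerD.
    by rewrite ler_wpM2l ?P1_le // divr_ge0 // ltW.
  by rewrite ler_wpM2l // invr_ge0 mulr_ge0 // ltW.
by apply: eq_ler; field; rewrite !lt0r_neq0.
Qed.


(** Cauchy-Schwarz for [|x u|] against [x^-1], whose square has primitive [- x^-1]. The weight
    [(N * q)^-1] makes each of the two terms [N / (2 * q)]. *)
Lemma increment_tail (q a b : R) : 0 < q -> q ^+ 2 <= a -> a <= b ->
  `|H b - H a| <= N / q.
Proof.
move=> q0 qa ab; have a0 : 0 < a by exact: (lt_le_trans (exprn_gt0 2 q0)).
have b0 : 0 < b by exact: lt_le_trans ab.
have k0 : 0 < (N * q)^-1 by rewrite invr_gt0 mulr_gt0.
have : `|H b - H a| <= ((N * q)^-1 / 2 * P2 b + N * q / 2 * - b^-1) -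
   ((N * q)^-1 / 2 * P2 a + N * q / 2 * - a^-1).
  notypeclasses refine (@ler_norm_increment _ H _
    (fun x => (N * q)^-1 / 2 * P2 x + N * q / 2 * - x^-1)
    (fun x => (N * q)^-1 / 2 * (x * u x) ^+ 2 + N * q / 2 * (x ^+ 2)^-1) _ _ ab
    (fun x _ => der_H x) _ _) => y /andP[ay _].
  - have y0 : y != 0 by apply: lt0r_neq0; exact: lt_le_trans ay.
    by have H2 := der_P2 y; der; rewrite /=; field; rewrite y0 !lt0r_neq0.
  - apply: (le_trans (norm_cosM_le _ _)).
    have := amgm_weight (u y) k0 (lt_le_trans a0 ay).
    have -> // : (2 * (N * q)^-1)^-1 = N * q / 2.
    by field; rewrite !lt0r_neq0.
move=> /le_trans; apply.
have -> : (N * q)^-1 / 2 * P2 b + N * q / 2 * - b^-1 -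
   ((N * q)^-1 / 2 * P2 a + N * q / 2 * - a^-1) =
  (N * q)^-1 / 2 * (P2 b - P2 a) + N * q / 2 * (a^-1 - b^-1) by ring.
apply: (@le_trans _ _ ((N * q)^-1 / 2 * N ^+ 2 + N * q / 2 * (q ^+ 2)^-1)).
  apply: lerD.
    by apply: ler_wpM2l; [rewrite divr_ge0 // ltW|apply: P2_le => //; exact: ltW].
  apply: ler_wpM2l; first by rewrite divr_ge0 // mulr_ge0 // ltW.
  apply: (@le_trans _ _ a^-1); first by rewrite gerBl invr_ge0 ltW.
  by rewrite lef_pV2 ?posrE // exprn_gt0.
by apply: eq_ler; field; rewrite !lt0r_neq0.
Qed.

Variables (dpsi ddpsi : R -> R).

(* One integration by parts, written as the comparison of
   [H - sin psi * u / psi'] with an explicit majorant. Since [psi'] is monotone,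
   [1 / psi'] absorbs the term in [psi'']. *)
Lemma increment_nonstationary (q a b r : R) :
  0 < q -> q ^+ 2 <= a -> a <= b -> 0 < r ->
  (forall x, a <= x <= b -> is_derive x 1 psi (dpsi x)) ->
  (forall x, a <= x <= b -> is_derive x 1 dpsi (ddpsi x)) ->
  (forall x, a <= x <= b -> ddpsi x <= 0) ->
  (forall x, a <= x <= b -> r <= `|dpsi x|) ->
  `|H b - H a| <= 9 * N / (q * r).
Proof.
move=> q0 qa ab r0 Hpsi Hdpsi dd0 rd.
have a0 : 0 < a by exact: (lt_le_trans (exprn_gt0 2 q0)).
have d0 x : a <= x <= b -> 0 < `|dpsi x| by move=> /rd; exact: lt_le_trans.
have d0' x : a <= x <= b -> dpsi x != 0 by move=> /d0; rewrite normr_gt0.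
have inv_le x : a <= x <= b -> `|(dpsi x)^-1| <= r^-1.
  by move=> xab; rewrite normfV lef_pV2 ?posrE ?d0 ?rd.
have aab : a <= a <= b by rewrite lexx.
have bab : a <= b <= b by rewrite lexx andbT.
pose k := (N * q)^-1; have k0 : 0 < k by rewrite invr_gt0 mulr_gt0.
pose M := 2 * N / q; have M0 : 0 < M by rewrite !mulr_gt0 ?invr_gt0.
have uM x : a <= x <= b -> `|u x| <= M.
  by move=> /andP[ax _]; apply: amp_le_sqrt => //; exact: le_trans ax.
pose D x := sin (psi x) * (u x * (dpsi x)^-1).
pose G x := r^-1 * (k / 2 * P3 x + (2 * k)^-1 * - x^-1) + M * (dpsi x)^-1.
have D_le x : a <= x <= b -> `|D x| <= M / r.
  move=> xab; rewrite normrM -[leRHS]mul1r; apply: ler_pM => //.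
    by rewrite ler_norml sin_geN1 sin_le1.
  by rewrite normrM; apply: ler_pM => //; [exact: uM|exact: inv_le].
have : `|(H b - D b) - (H a - D a)| <= G b - G a.
  notypeclasses refine (@ler_norm_increment _ (fun x => H x - D x)
    (fun x => - sin (psi x) * (du x * (dpsi x)^-1 - u x * (ddpsi x / dpsi x ^+ 2)))
    G (fun x => r^-1 * (k / 2 * (x * du x) ^+ 2 + (2 * k)^-1 * (x ^+ 2)^-1)
      + M * (- ddpsi x / dpsi x ^+ 2)) _ _ ab _ _ _) => y yab.
  - have nz := d0' _ yab.
    have H1 := der_H y; have H2 := der_u y.
    have H3 := Hpsi _ yab; have H4 := Hdpsi _ yab.
    by rewrite /D; der; rewrite /=; field.
  - have nz := d0' _ yab.
    have y0 : y != 0.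
      by move: yab => /andP[ay _]; rewrite lt0r_neq0 // (lt_le_trans a0).
    have H2 := der_P3 y; have H4 := Hdpsi _ yab.
    by rewrite /G; der; rewrite /=; field; rewrite nz y0 !lt0r_neq0.
  - have y0 : 0 < y by move: yab => /andP[ay _]; exact: lt_le_trans ay.
    rewrite normrM normrN -[leRHS]mul1r; apply: ler_pM => //.
      by rewrite ler_norml sin_geN1 sin_le1.
    apply: (le_trans (ler_normB _ _)); apply: lerD.
      rewrite normrM mulrC; apply: ler_pM => //; first exact: inv_le.
      exact: amgm_weight.
    rewrite normrM; apply: ler_pM => //; first exact: uM.
    rewrite normrM normfV normrX (real_normK (num_real _)) ler0_norm ?dd0 //.
set DG := G b - G a => main.
have DGle : DG <= N / (q * r) + 2 * (M / r).
  have -> : DG = r^-1 * (k / 2 * (P3 b - P3 a) + (2 * k)^-1 * (a^-1 - b^-1)) +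
     (M * (dpsi b)^-1 - M * (dpsi a)^-1).
    by rewrite /DG /G; ring.
  apply: lerD.
    have -> : N / (q * r) =
        r^-1 * (k / 2 * N ^+ 2 + (2 * k)^-1 * (q ^+ 2)^-1).
      by rewrite /k; field; rewrite !lt0r_neq0.
    apply: ler_wpM2l; first by rewrite invr_ge0 ltW.
    apply: lerD; apply: ler_wpM2l.
    - by rewrite divr_ge0 // ltW.
    - by apply: P3_le => //; exact: ltW.
    - by rewrite invr_ge0 mulr_ge0 // ltW.
    - apply: (@le_trans _ _ a^-1).
        by rewrite gerBl invr_ge0 ltW // (lt_le_trans a0).
      by rewrite lef_pV2 ?posrE // exprn_gt0.
  apply: (le_trans (ler_norm _)); apply: (le_trans (ler_normB _ _)).
  rewrite !(normrM M) (ger0_norm (ltW M0)) -mulrDr mulrCA ler_pM2l //.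
  have := inv_le _ aab; have := inv_le _ bab; lra.
have := D_le _ aab; have := D_le _ bab => Db Da.
have -> : H b - H a = (H b - D b - (H a - D a)) + (D b - D a) by ring.
apply: (le_trans (ler_normD _ _)).
have DD : `|D b - D a| <= 2 * (M / r).
  by apply: (le_trans (ler_normB _ _)); lra.
(* The 9 is 1 + 4 + 4: the energy of [x u'], the variation of [1 / psi'], and the two boundary
   values of [D], the last two with [M = 2 N / q]. *)
have -> : 9 * N / (q * r) = N / (q * r) + 2 * (M / r) + 2 * (M / r).
  by rewrite /M; field; rewrite !lt0r_neq0.
by apply: lerD => //; exact: le_trans DGle.
Qed.

Lemma increment_window (p w M a b : R) : 0 <= M -> 0 < w -> a <= p <= b ->
  p - w <= a -> b <= p + w ->
  (forall x, a <= x <= b -> `|u x| <= M) -> `|H b - H a| <= 2 * w * M.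
Proof.
move=> M0 w0 /andP[ap pb] pa bp uM; have ab := le_trans ap pb.
have : `|H b - H a| <= M * b - M * a.
  notypeclasses refine (@ler_norm_increment _ H _ (fun x => M * x) (fun=> M)
    _ _ ab (fun x _ => der_H x) _ _) => y yab.
  - by der; rewrite mul0r add0r mulr1.
  - by apply: (le_trans (norm_cosM_le _ _)); exact: uM.
move=> /le_trans; apply; rewrite -mulrBr mulrC ler_wpM2r //; lra.
Qed.

(** Trivial bound on the window around [p], nonstationary bound on either side. The window is
    clipped to [[a, b]], so [p] may be an endpoint or close to one; the corresponding side is then
    empty. It need not be a zero of [psi']. *)
Lemma increment_stationary (q a b p w r M : R) :
  0 < q -> q ^+ 2 <= a -> a <= p <= b -> 0 < w -> 0 < r -> 0 <= M ->
  (forall x, a <= x <= b -> is_derive x 1 psi (dpsi x)) ->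
  (forall x, a <= x <= b -> is_derive x 1 dpsi (ddpsi x)) ->
  (forall x, a <= x <= b -> ddpsi x <= 0) ->
  (forall x, a <= x <= b -> p - w <= x -> x <= p + w -> `|u x| <= M) ->
  (forall x, a <= x <= b -> x <= p - w -> r <= dpsi x) ->
  (forall x, a <= x <= b -> p + w <= x -> dpsi x <= - r) ->
  `|H b - H a| <= 2 * w * M + 18 * N / (q * r).
Proof.
move=> q0 qa /andP[ap pb] w0 r0 M0 Hpsi Hdpsi dd0 uM rl rr.
have B0 : 0 <= 9 * N / (q * r) by rewrite divr_ge0 // mulr_ge0 // ltW.
pose a1 := Num.max a (p - w); pose b1 := Num.min b (p + w).
have aa1 : a <= a1 by rewrite le_max lexx.
have a1p : a1 <= p by rewrite ge_max ap gerBl ltW.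
have pb1 : p <= b1 by rewrite le_min pb lerDl ltW.
have b1b : b1 <= b by rewrite ge_min lexx.
have sub x y z : a <= y -> z <= b -> y <= x <= z -> a <= x <= b.
  by move=> ay zb /andP[yx xz]; rewrite (le_trans ay yx) (le_trans xz zb).
have L : `|H a1 - H a| <= 9 * N / (q * r).
  have [paw|paw] := leP (p - w) a.
    by rewrite /a1 max_l // subrr normr0.
  have ea : a1 = p - w by rewrite /a1 max_r // ltW.
  have a1b : a1 <= b by apply: le_trans pb.
  apply: increment_nonstationary => // x xa1; have xab := sub _ _ _ (lexx a) a1b xa1.
  - exact: Hpsi.
  - exact: Hdpsi.
  - exact: dd0.
  - apply: le_trans (ler_norm _); apply: rl => //.
    by rewrite -ea; case/andP: xa1.
have Rr : `|H b - H b1| <= 9 * N / (q * r).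
  have [pbw|pbw] := leP b (p + w).
    by rewrite /b1 min_l // subrr normr0.
  have eb : b1 = p + w by rewrite /b1 min_r // ltW.
  have ab1 : a <= b1 by apply: le_trans pb1.
  have xab := sub _ _ _ ab1 (lexx b).
  apply: increment_nonstationary => // [|x /xab|x /xab|x /xab|x xb1].
  - exact: le_trans ab1.
  - exact: Hpsi.
  - exact: Hdpsi.
  - exact: dd0.
  - rewrite -normrN; apply: le_trans (ler_norm _).
    rewrite lerNr; apply: rr; first exact: xab.
    by rewrite -eb; case/andP: xb1.
have W : `|H b1 - H a1| <= 2 * w * M.
  apply: (@increment_window p) => //; first by rewrite a1p.
  - by rewrite le_max lexx orbT.
  - by rewrite ge_min lexx orbT.
  move=> x xab; apply: uM; first exact: sub xab.
    by case/andP: xab => + _; apply: le_trans; rewrite le_max lexx orbT.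
  by case/andP: xab => _ /le_trans; apply; rewrite ge_min lexx orbT.
have -> : H b - H a = (H b - H b1) + (H b1 - H a1) + (H a1 - H a) by ring.
apply: (le_trans (ler_normD _ _)).
have := ler_normD (H b - H b1) (H b1 - H a1).
have -> : 18 * N / (q * r) = 2 * (9 * N / (q * r)) by ring.
lra.
Qed.

End Phase.

(** Stands in for the stationary point, which may lie outside [[a, b]]: for a decreasing [f] the
    point [p] then degenerates to the endpoint nearest to it. The disjunctions drop a sign condition
    exactly when no point of the interval lies on that side. *)
Lemma sign_change (f : R -> R) (a b : R) : a <= b ->
  {within `[a, b], continuous f}%classic ->
  exists2 p, a <= p <= b & (p = a \/ 0 <= f p) /\ (p = b \/ f p <= 0).
Proof.
move=> ab cf.
have [fa|fa] := leP (f a) 0; first by exists a; rewrite ?lexx ?ab; auto.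
have [fb|fb] := leP 0 (f b); first by exists b; rewrite ?lexx ?ab; auto.
have [|p] := @IVT _ f a b 0 ab cf.
  by rewrite ge_min le_max (ltW fa) (ltW fb) orbT.
by rewrite in_itv /= => pab fp; exists p => //; rewrite fp; auto.
Qed.

(* The time is [t = e ^+ 8 * sqrt mu] with [mu = n ^+ 4], so that every power in
   the final estimate is an integral power of [e] and [n]. *)
Section WaterWave.
Variable c : R.
Hypothesis c0 : 0 < c.
Hypothesis disp2_small : forall x : R, 0 < x -> x <= 1 -> disp2 x <= - (c * x).
Hypothesis disp2_large : forall x : R, 1 <= x ->
  disp2 x <= - (c / (x * Num.sqrt x)).
Variables (x th e n : R) (H : R -> R).
Hypothesis e1 : 1 <= e.
Hypothesis n0 : 0 < n.

Let psi (y : R) : R := x * y + e ^+ 8 * disp (n ^+ 2 * y) + th.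
Let dpsi (y : R) : R := x + e ^+ 8 * n ^+ 2 * disp1 (n ^+ 2 * y).
Let ddpsi (y : R) : R := e ^+ 8 * n ^+ 4 * disp2 (n ^+ 2 * y).
Hypothesis der_H : forall y : R, is_derive y 1 H (cos (psi y) * u y).

Let e0 : 0 < e. Proof. exact: lt_le_trans e1. Qed.
Let n2 (y : R) : 0 < y -> 0 < n ^+ 2 * y.
Proof. by move=> y0; rewrite mulr_gt0 // exprn_gt0. Qed.

Let der_psi (y : R) : 0 < y -> is_derive y 1 psi (dpsi y).
Proof.
move=> y0; rewrite /psi; have Hd := der_disp (n2 y0).
have Hl : is_derive y 1 (fun y : R => n ^+ 2 * y) (n ^+ 2).
  by der; rewrite mul0r add0r mulr1.
have Hc := der_comp Hd Hl.
by der; rewrite /dpsi /=; ring.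
Qed.

Let der_dpsi (y : R) : 0 < y -> is_derive y 1 dpsi (ddpsi y).
Proof.
move=> y0; rewrite /dpsi; have Hd := der_disp1 (n2 y0).
have Hl : is_derive y 1 (fun y : R => n ^+ 2 * y) (n ^+ 2).
  by der; rewrite mul0r add0r mulr1.
have Hc := der_comp Hd Hl.
by der; rewrite /ddpsi /=; ring.
Qed.

Lemma disp2_le0 (y : R) : 0 < y -> disp2 y <= 0.
Proof.
move=> y0; have [y1|/ltW y1] := leP y 1.
  by apply: (le_trans (disp2_small y0 y1)); rewrite oppr_le0 mulr_ge0 // ltW.
apply: (le_trans (disp2_large y1)); rewrite oppr_le0 divr_ge0 ?mulr_ge0 ?sqrtr_ge0 //.
  exact: ltW.
exact: ltW.
Qed.

Let ddpsi_le0 (y : R) : 0 < y -> ddpsi y <= 0.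
Proof.
move=> y0; rewrite /ddpsi mulr_ge0_le0 ?disp2_le0 ?n2 //.
by rewrite mulr_ge0 // exprn_ge0 // ltW.
Qed.

Let dpsi_decr (rho a b : R) : 0 < a -> a <= b ->
  (forall y, a <= y <= b -> ddpsi y <= - rho) -> rho * (b - a) <= dpsi a - dpsi b.
Proof.
move=> a0 ab H2.
have : dpsi b - dpsi a <= - rho * b - - rho * a.
  notypeclasses refine (@ler_increment _ dpsi ddpsi (fun y => - rho * y)
    (fun=> - rho) _ _ ab _ _ _) => y yab.
  - by apply: der_dpsi; case/andP: yab => + _; exact: lt_le_trans.
  - by der; rewrite mul0r add0r mulr1.
  - exact: H2.
rewrite mulrBr; lra.
Qed.

Let sign_change_dpsi (a b : R) : 0 < a -> a <= b ->
  exists2 p, a <= p <= b & (p = a \/ 0 <= dpsi p) /\ (p = b \/ dpsi p <= 0).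
Proof.
move=> a0 ab; apply: sign_change => //.
apply: derivable_within_continuous => y; rewrite in_itv /= => /andP[ay _].
by have [] := der_dpsi (lt_le_trans a0 ay).
Qed.

(** On this range [- psi''] is at least [c e^6 n^4], its bound at the left end, and
    [|u| <= 2 N n e]. The half-width [(e^3 n^2)^-1] is the inverse square root of [e^6 n^4], which
    balances the window against the two sides. *)
Lemma increment_low :
  `|H (n ^- 2) - H ((n * e) ^- 2)| <= (4 + 18 / c) * (N / (n * e)).
Proof.
have ne0 : 0 < n * e by rewrite mulr_gt0.
have a0 : 0 < (n * e) ^- 2 by rewrite invr_gt0 exprn_gt0.
have ab : (n * e) ^- 2 <= n ^- 2.
  rewrite lef_pV2 ?posrE ?exprn_gt0 // lerXn2r ?nnegrE ?(ltW ne0) ?(ltW n0) //.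
  by rewrite ler_peMr // ltW.
have [p /andP[ap pb] [pa pb']] := sign_change_dpsi a0 ab.
have rho y : (n * e) ^- 2 <= y <= n ^- 2 -> ddpsi y <= - (c * e ^+ 6 * n ^+ 4).
  move=> /andP[ay yb]; have y0 := lt_le_trans a0 ay.
  rewrite /ddpsi; apply: (@le_trans _ _ (e ^+ 8 * n ^+ 4 * - (c * (n ^+ 2 * y)))).
    apply: ler_wpM2l; first by rewrite mulr_ge0 // exprn_ge0 // ltW.
    apply: disp2_small; first exact: n2.
    by rewrite mulrC -ler_pdivlMr ?exprn_gt0 // mul1r.
  rewrite mulrN lerN2.
  apply: (@le_trans _ _ (e ^+ 8 * n ^+ 4 * (c * (n ^+ 2 * (n * e) ^- 2)))).
    by apply: eq_ler; field; rewrite !lt0r_neq0.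
  apply: ler_wpM2l; first by rewrite mulr_ge0 // exprn_ge0 // ltW.
  by rewrite ler_pM2l // ler_pM2l // exprn_gt0.
have ew : (0 : R) < e ^+ 3 * n ^+ 2 by rewrite mulr_gt0 ?exprn_gt0.
have w0 : 0 < (e ^+ 3 * n ^+ 2)^-1 by rewrite invr_gt0.
have dec y z : (n * e) ^- 2 <= y -> y <= z -> z <= n ^- 2 ->
    c * e ^+ 6 * n ^+ 4 * (z - y) <= dpsi y - dpsi z.
  move=> ay yz zb; apply: dpsi_decr => //; first exact: lt_le_trans ay.
  by move=> t /andP[yt tz]; apply: rho; rewrite (le_trans ay yt) (le_trans tz zb).
have rw : c * (e ^+ 3 * n ^+ 2) =
   c * e ^+ 6 * n ^+ 4 * (e ^+ 3 * n ^+ 2)^-1 by field; rewrite !lt0r_neq0.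
have R0 : 0 < c * e ^+ 6 * n ^+ 4 by rewrite !mulr_gt0 ?exprn_gt0.
have pos y : (n * e) ^- 2 <= y <= n ^- 2 -> 0 < y.
  by move=> /andP[+ _]; exact: lt_le_trans.
apply: (@le_trans _ _ (2 * (e ^+ 3 * n ^+ 2)^-1 * (2 * N / (n * e)^-1) +
    18 * N / ((n * e)^-1 * (c * (e ^+ 3 * n ^+ 2))))).
  apply: (@increment_stationary H psi der_H dpsi ddpsi _ _ _ p).
  - by rewrite invr_gt0.
  - by rewrite exprVn.
  - by rewrite ap.
  - exact: w0.
  - by rewrite mulr_gt0.
  - by rewrite divr_ge0 ?mulr_ge0 ?invr_ge0 ?ltW.
  - by move=> y /pos; exact: der_psi.
  - by move=> y /pos; exact: der_dpsi.
  - by move=> y /pos; exact: ddpsi_le0.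
  - by move=> y /andP[ay _] _ _; apply: amp_le_sqrt; rewrite ?invr_gt0 // exprVn.
  - move=> y /andP[ay _] yp; have yp' : y <= p by rewrite (le_trans yp) // gerBl ltW.
    have := dec _ _ ay yp' pb.
    (* If [p] is the left end, no point of the interval is left of [p - w]; otherwise [psi' p >= 0]
       and the decrease of [psi'] from [y] to [p] is a lower bound for [psi' y]. *)
    case: pa => [pa|pa]; first by move: w0; rewrite pa in yp; lra.
    rewrite rw; have : c * e ^+ 6 * n ^+ 4 * (e ^+ 3 * n ^+ 2)^-1 <=
      c * e ^+ 6 * n ^+ 4 * (p - y) by rewrite ler_pM2l //; lra.
    by lra.
  - move=> y /andP[_ yb] yp; have yp' : p <= y by rewrite (le_trans _ yp) // lerDl ltW.
    have := dec _ _ ap yp' yb.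
    case: pb' => [pb'|pb']; first by move: w0; rewrite pb' in yp; lra.
    rewrite rw; have : c * e ^+ 6 * n ^+ 4 * (e ^+ 3 * n ^+ 2)^-1 <=
      c * e ^+ 6 * n ^+ 4 * (y - p) by rewrite ler_pM2l //; lra.
    by lra.
(* Both contributions are of order [N / (n e^2)], so a factor [e^-1] is to spare: the rate
   [N / (n e)] is dictated by the piece near 0, not by this one. *)
have -> : 2 * (e ^+ 3 * n ^+ 2)^-1 * (2 * N / (n * e)^-1) +
    18 * N / ((n * e)^-1 * (c * (e ^+ 3 * n ^+ 2))) =
  (4 + 18 / c) * (N / (n * e)) * e^-1.
  by field; rewrite !lt0r_neq0.
apply: ler_piMr; last by rewrite invf_le1.
apply: mulr_ge0; first by rewrite addr_ge0 // divr_ge0 // ltW.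
by rewrite divr_ge0 // ltW.
Qed.

(* Near the stationary point [p] the window has relative width [e ^- 4 / 2], and
   [u] is bounded there by [N / p], not merely by [N / sqrt p]: the latter
   would lose too much at high frequency. *)
Lemma increment_high : n ^- 2 <= e ^+ 8 ->
  `|H (e ^+ 8) - H (n ^- 2)| <=
    (4 + 144 / c) * (N / e ^+ 4) + 576 / c * (N / (n * e ^+ 4)).
Proof.
move=> ab; have a0 : 0 < n ^- 2 by rewrite invr_gt0 exprn_gt0.
have [p /andP[ap pb] [pa pb']] := sign_change_dpsi a0 ab.
have p0 : 0 < p by exact: lt_le_trans ap.
pose P := Num.sqrt p; have P0 : 0 < P by rewrite sqrtr_gt0.
have pP : p = P ^+ 2 by rewrite sqr_sqrtr // ltW.
have P8 : 0 < 8 * P ^+ 3 by rewrite mulr_gt0 // exprn_gt0.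
have Pe : P <= e ^+ 4.
  rewrite -ler_sqr ?nnegrE ?(ltW P0) ?exprn_ge0 ?(ltW e0) // -pP.
  by rewrite -exprM.
have e40 : 0 < e ^+ 4 by rewrite exprn_gt0.
have e41 : 1 <= e ^+ 4 by rewrite exprn_ege1.
(* Lower bound of [- psi''] up to [4 * p], since [8 * P ^+ 3] is [(4 p)^(3/2)]. The curvature
   decays, so farther to the right only the monotonicity of [psi'] is used. *)
pose rho := c * e ^+ 8 * n / (8 * P ^+ 3).
have rho0 : 0 < rho by rewrite divr_gt0 // !mulr_gt0 // exprn_gt0.
have Hrho y : n ^- 2 <= y -> y <= 4 * p -> ddpsi y <= - rho.
  move=> ay yp; have y0 := lt_le_trans a0 ay.
  have sy : 0 < Num.sqrt y by rewrite sqrtr_gt0.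
  have ny : 1 <= n ^+ 2 * y by rewrite mulrC -ler_pdivrMr ?exprn_gt0 // mul1r.
  apply: (@le_trans _ _ (e ^+ 8 * n ^+ 4 *
      - (c / (n ^+ 2 * y * Num.sqrt (n ^+ 2 * y))))).
    apply: ler_wpM2l; first by rewrite mulr_ge0 // exprn_ge0 // ltW.
    exact: disp2_large.
  rewrite mulrN lerN2 sqrtrM ?exprn_ge0 ?(ltW n0) // sqrtr_sqr (gtr0_norm n0).
  have -> : e ^+ 8 * n ^+ 4 * (c / (n ^+ 2 * y * (n * Num.sqrt y))) =
     c * e ^+ 8 * n / (y * Num.sqrt y) by field; rewrite !lt0r_neq0.
  rewrite ler_pM2l ?mulr_gt0 ?exprn_gt0 // lef_pV2 ?posrE ?mulr_gt0 //.
  have -> : 8 * P ^+ 3 = (4 * p) * (2 * P) by rewrite pP; ring.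
  apply: ler_pM; [exact: ltW|exact: ltW|by []|].
  rewrite -ler_sqr ?nnegrE ?(ltW sy) ?mulr_ge0 ?(ltW P0) //.
  by rewrite sqr_sqrtr ?(ltW y0) // exprMn -pP -natrX.
have dec y z : n ^- 2 <= y -> y <= z -> z <= 4 * p ->
    rho * (z - y) <= dpsi y - dpsi z.
  move=> ay yz zb; apply: dpsi_decr => //; first exact: lt_le_trans ay.
  by move=> t /andP[yt tz]; apply: Hrho; [exact: le_trans yt|exact: le_trans zb].
have mon y z : n ^- 2 <= y -> y <= z -> dpsi z <= dpsi y.
  move=> ay yz; rewrite -subr_ge0 -(mul0r (z - y)).
  apply: dpsi_decr => //; first exact: lt_le_trans ay.
  move=> t /andP[yt _]; rewrite oppr0; apply: ddpsi_le0.
  exact: lt_le_trans (lt_le_trans a0 ay) yt.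
(* The nonstationary bound loses [1 / q] with [q^2] below the left end of the interval. Far from [p]
   the poor value [q = n^-1] is affordable because [psi'] is at least [rho * (p / 2)]; close to [p],
   where [psi'] is smaller, the cut at [p / 4] allows [q = P / 2]. *)
pose a' := Num.max (n ^- 2) (p / 4).
have aa' : n ^- 2 <= a' by rewrite le_max lexx.
have a'p : a' <= p by rewrite ge_max ap /=; move: p0; lra.
have L : `|H a' - H (n ^- 2)| <= 144 / c * (N / e ^+ 4).
  have [pan|pan] := leP (p / 4) (n ^- 2).
    rewrite /a' max_l // subrr normr0 mulr_ge0 // divr_ge0 //; exact: ltW.
  have -> : a' = p / 4 by rewrite /a' max_r // ltW.
  apply: (@le_trans _ _ (9 * N / (n^-1 * (c * e ^+ 8 * n / (16 * P))))).
    apply: (@increment_nonstationary H psi der_H dpsi ddpsi).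
    - by rewrite invr_gt0.
    - by rewrite exprVn.
    - exact: ltW.
    - by rewrite divr_gt0 ?mulr_gt0 ?exprn_gt0.
    - by move=> y /andP[ay _]; apply: der_psi; exact: lt_le_trans ay.
    - by move=> y /andP[ay _]; apply: der_dpsi; exact: lt_le_trans ay.
    - by move=> y /andP[ay _]; apply: ddpsi_le0; exact: lt_le_trans ay.
    - move=> y /andP[ay yp]; apply: le_trans (ler_norm _).
      have := mon _ _ ay yp.
      have := dec (p / 4) p (ltW pan); case: pa => [pa|pa].
        by move: pan p0; rewrite -pa; lra.
      have h1 : p / 4 <= p by move: p0; lra.
      have h2 : p <= 4 * p by move: p0; lra.
      move=> /(_ h1 h2).
      have -> : c * e ^+ 8 * n / (16 * P) = rho * (p / 2).
        by rewrite /rho pP; field; rewrite !lt0r_neq0.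
      have : rho * (p / 2) <= rho * (p - p / 4).
        by rewrite ler_pM2l //; move: p0; lra.
      by lra.
  have -> : 9 * N / (n^-1 * (c * e ^+ 8 * n / (16 * P))) =
    144 / c * (N / e ^+ 4) * (P / e ^+ 4) by field; rewrite !lt0r_neq0.
  apply: ler_piMr; last by rewrite ler_pdivrMr // mul1r.
  by rewrite mulr_ge0 // divr_ge0 //; exact: ltW.
have w0 : 0 < P ^+ 2 / (2 * e ^+ 4) by rewrite divr_gt0 ?exprn_gt0 ?mulr_gt0.
have wp : P ^+ 2 / (2 * e ^+ 4) <= p / 2.
  by rewrite -pP ler_pM2l // lef_pV2 ?posrE ?mulr_gt0 // ler_peMr.
have rw : c * e ^+ 4 * n / (16 * P) = rho * (P ^+ 2 / (2 * e ^+ 4)).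
  by rewrite /rho; field; rewrite !lt0r_neq0.
have Rr : `|H (e ^+ 8) - H a'| <= 4 * (N / e ^+ 4) + 576 / c * (N / (n * e ^+ 4)).
  have -> : 4 * (N / e ^+ 4) + 576 / c * (N / (n * e ^+ 4)) =
     2 * (P ^+ 2 / (2 * e ^+ 4)) * (2 * N / (p / 2)) +
     18 * N / ((P / 2) * (c * e ^+ 4 * n / (16 * P))).
    by rewrite pP; field; rewrite !lt0r_neq0.
  have pos y : a' <= y <= e ^+ 8 -> 0 < y.
    by move=> /andP[ay _]; exact: lt_le_trans (lt_le_trans a0 aa') ay.
  apply: (@increment_stationary H psi der_H dpsi ddpsi _ _ _ p).
  - by rewrite divr_gt0.
  - by rewrite exprMn -pP exprVn -natrX le_max lexx orbT.
  - by rewrite a'p.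
  - exact: w0.
  - by rewrite divr_gt0 ?mulr_gt0 ?exprn_gt0.
  - by rewrite divr_ge0 ?mulr_ge0 ?invr_ge0 ?ltW.
  - by move=> y /pos; exact: der_psi.
  - by move=> y /pos; exact: der_dpsi.
  - by move=> y /pos; exact: ddpsi_le0.
  - by move=> y _ yp _; apply: amp_le; [rewrite divr_gt0|move: yp wp; lra].
  - move=> y /andP[ay _] yp.
    have yp' : y <= p by rewrite (le_trans yp) // gerBl ltW.
    have p4 : p <= 4 * p by move: p0; lra.
    have := dec _ _ (le_trans aa' ay) yp' p4.
    case: pa => [pa|pa].
      by move: w0 (le_trans aa' ay); rewrite -pa; lra.
    have : rho * (P ^+ 2 / (2 * e ^+ 4)) <= rho * (p - y) by rewrite ler_pM2l //; lra.
    by rewrite rw; lra.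
  - move=> y /andP[_ yb] yp.
    (* Here [y] may exceed [4 * p]: the decrease of [psi'] is collected between [p] and the edge of
       the window, and monotonicity carries it on to [y]. *)
    have p4 : p + P ^+ 2 / (2 * e ^+ 4) <= 4 * p by move: wp p0; lra.
    have pw : p <= p + P ^+ 2 / (2 * e ^+ 4) by rewrite lerDl ltW.
    have := dec _ _ ap pw p4; have := mon _ _ (le_trans ap pw) yp.
    case: pb' => [pb'|pb'].
      by move: w0 yb; rewrite -pb'; lra.
    by rewrite rw (addrC p) addrK; lra.
have -> : H (e ^+ 8) - H (n ^- 2) = (H (e ^+ 8) - H a') + (H a' - H (n ^- 2)) by ring.
apply: (le_trans (ler_normD _ _)); lra.
Qed.

(** Sum of the four pieces. The coefficients are [5 + 594 / c] for [N / (n e)] and [5 + 144 / c] for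
    [N / e^4]; the constant is their sum. *)
Lemma oscillatory_increment (b : R) : n ^- 2 <= b -> e ^+ 8 <= b ->
  `|H b - H 0| <= (10 + 738 / c) * (N * ((n * e)^-1 + e ^- 4)).
Proof.
move=> nb eb; have ne0 : 0 < n * e by rewrite mulr_gt0.
have e40 : 0 < e ^+ 4 by rewrite exprn_gt0.
have a0 : 0 <= (n * e) ^- 2 by rewrite invr_ge0 exprn_ge0 // ltW.
have Z0 : `|H ((n * e) ^- 2) - H 0| <= N / (n * e).
  apply: (@increment_near0 H psi der_H) => //; first by rewrite invr_gt0.
  by rewrite exprVn.
have Z1 := increment_low.
have X0 : 0 <= N / (n * e) by rewrite divr_ge0 // ltW.
have Y0 : 0 <= N / e ^+ 4 by rewrite divr_ge0 // ltW.
have cX : 0 <= c^-1 * (N / (n * e)) by rewrite mulr_ge0 // invr_ge0 ltW.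
have cY : 0 <= c^-1 * (N / e ^+ 4) by rewrite mulr_ge0 // invr_ge0 ltW.
have Z2 : `|H b - H (n ^- 2)| <=
    (5 + 144 / c) * (N / e ^+ 4) + 576 / c * (N / (n * e)).
  have T y : e ^+ 8 <= y -> y <= b -> `|H b - H y| <= N / e ^+ 4.
    by move=> ey yb; apply: (@increment_tail H psi der_H) => //; rewrite -exprM.
  (* If the cut [e ^+ 8] is below [n ^- 2], the high range is absent and the tail starts at
     [n ^- 2]. *)
  have [en|/ltW en] := leP (e ^+ 8) (n ^- 2).
    by apply: (le_trans (T _ en nb)); move: X0 Y0 cX cY; lra.
  have -> : H b - H (n ^- 2) = (H b - H (e ^+ 8)) + (H (e ^+ 8) - H (n ^- 2)) by ring.
  apply: (le_trans (ler_normD _ _)).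
  have := T _ (lexx _) eb; have := increment_high en.
  have : 576 / c * (N / (n * e ^+ 4)) <= 576 / c * (N / (n * e)).
    have k0 : 0 < 576 / c by apply: divr_gt0; [rewrite ltr0n|exact: c0].
    rewrite (ler_pM2l k0) ler_pM2l // lef_pV2 ?posrE ?mulr_gt0 //.
    rewrite ler_pM2l // exprS ler_peMr ?(ltW e0) // exprn_ege1 //.
  lra.
have -> : H b - H 0 = (H b - H (n ^- 2)) + (H (n ^- 2) - H ((n * e) ^- 2)) +
  (H ((n * e) ^- 2) - H 0) by ring.
apply: (le_trans (ler_normD _ _)).
have := ler_normD (H b - H (n ^- 2)) (H (n ^- 2) - H ((n * e) ^- 2)).
rewrite mulrDr; move: X0 Y0 cX cY Z0 Z1 Z2; lra.
Qed.

End WaterWave.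

End Oscillation.

(** * Integration on the real line *)

Section RealIntegral.
Context {R : realType}.
Local Open Scope classical_set_scope.
Local Open Scope ring_scope.
Local Notation mu := (@lebesgue_measure R).
Implicit Types (f g : R -> R) (a b : R).

Lemma continuous_integrable_itv f a b : continuous f ->
  mu.-integrable `[a, b] (EFin \o f).
Proof.
move=> cf; apply: continuous_compact_integrable; first exact: segment_compact.
exact: continuous_subspaceT.
Qed.

Lemma Rintegral_itv_split f a b c : continuous f -> a <= b -> b <= c ->
  \int[mu]_(x in `[a, c]) f x =
  \int[mu]_(x in `[a, b]) f x + \int[mu]_(x in `[b, c]) f x.
Proof.
move=> cf ab bc; have ic := continuous_integrable_itv a c cf.
have := @Rintegral_itvB R f (BLeft a) (BRight c) b ic.
rewrite !bnd_simp => /(_ ab bc) E.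
rewrite -[X in _ + X]Rintegral_itv_obnd_cbnd; last first.
  by apply: integrableS ic => //; apply: subset_itvr; rewrite bnd_simp.
by rewrite -E; ring.
Qed.

Lemma continuous_primitive f : continuous f ->
  exists F : R -> R, (forall x : R, is_derive x 1 F (f x)) /\
    (forall a b, a <= b -> F b - F a = \int[mu]_(x in `[a, b]) f x).
Proof.
move=> cf.
pose F y := if 0 <= y then \int[mu]_(x in `[0, y]) f x
            else - \int[mu]_(x in `[y, 0]) f x.
have FE A y : A <= 0 -> A <= y ->
    F y = \int[mu]_(x in `[A, y]) f x - \int[mu]_(x in `[A, 0]) f x.
  move=> A0 Ay; rewrite /F; case: leP => y0.
    by rewrite (Rintegral_itv_split cf A0 y0); ring.
  by rewrite (Rintegral_itv_split cf Ay (ltW y0)); ring.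
exists F; split=> [x|a b ab]; last first.
  pose A := Num.min a 0.
  have Aa : A <= a by rewrite ge_min lexx.
  have A0 : A <= 0 by rewrite ge_min lexx orbT.
  rewrite (FE A b) // ?(le_trans Aa) // (FE A a) //.
  by rewrite (Rintegral_itv_split cf Aa ab); ring.
(* The fundamental theorem needs a base point strictly to the left of [x]; near [x] the function [F]
   is the integral from [A] up to a constant. *)
pose A := Num.min x 0 - 1.
have Ax : A < x by rewrite /A ltrBlDr; apply: (@le_lt_trans _ _ x); [rewrite ge_min lexx|lra].
have A0 : A <= 0.
  by rewrite /A lerBlDr; apply: (@le_trans _ _ 0); [rewrite ge_min lexx orbT|lra].
apply: (@near_eq_is_derive _ _ _
    (fun y => \int[mu]_(x in `[A, y]) f x - \int[mu]_(x in `[A, 0]) f x)).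
  by near=> y; rewrite (FE A y) //; apply: ltW; near: y; exact: lt_nbhsr.
have x1 : x < x + 1 by rewrite ltrDl.
have [dF F'] := continuous_FTC1_closed x1 (continuous_integrable_itv A (x + 1) cf) Ax (cf x).
have dI : is_derive x 1 (fun y => \int[mu]_(x in `[A, y]) f x) (f x).
  by apply: DeriveDef; [exact: dF|rewrite -derive1E; exact: F'].
by rewrite -[f x]addr0; exact: derD dI (derC _ x).
Unshelve. all: by end_near.
Qed.

Lemma Rintegral_derivative f F a b : continuous f ->
  (forall x : R, is_derive x 1 F (f x)) -> a <= b ->
  \int[mu]_(x in `[a, b]) f x = F b - F a.
Proof.
move=> cf HF ab; have [G [HG <- //]] := continuous_primitive cf.
apply/eqP; rewrite eq_le; apply/andP; split.
  exact: (ler_increment ab (fun x _ => HG x) (fun x _ => HF x)).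
exact: (ler_increment ab (fun x _ => HF x) (fun x _ => HG x)).
Qed.

Lemma oneDsqr_gt0 (x : R) : 0 < oneDsqr x.
Proof. exact: lt_le_trans (oneDsqr_ge1 x). Qed.

Lemma oneDsqr_ge0 (x : R) : 0 <= oneDsqr x.
Proof. exact/ltW/oneDsqr_gt0. Qed.

Lemma integral_oneDsqrV : (\int[mu]_x ((oneDsqr x)^-1)%:E = pi%:E)%E.
Proof.
rewrite ge0_symfun_integralT //=.
- rewrite (_ : [set x | _] = `[0, +oo[%classic); last first.
    by apply/seteqP; split => x/=; rewrite in_itv/= andbT.
  by rewrite integral0y_oneDsqr -EFinM mulrCA divff// mulr1.
- exact: continuous_oneDsqrV.
- by move=> x /=; rewrite /oneDsqr sqrrN.
Qed.

Lemma integrable_oneDsqrV (M : R) :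
  mu.-integrable setT (EFin \o (fun x : R => M * (oneDsqr x)^-1)).
Proof.
have m1 : measurable_fun [set: R] (fun x : R => ((oneDsqr x)^-1)%:E).
  apply/measurable_EFinP; apply: continuous_measurable_fun.
  exact: continuous_oneDsqrV.
have i1 : mu.-integrable setT (EFin \o (fun x : R => (oneDsqr x)^-1)).
  apply/integrableP; split => //.
  under eq_integral do rewrite /= ger0_norm ?invr_ge0 ?oneDsqr_ge0 //.
  by rewrite integral_oneDsqrV ltry.
rewrite (_ : EFin \o _ = fun x => (M%:E * ((oneDsqr x)^-1)%R%:E)%E) //.
exact: integrableZl.
Qed.

Lemma integrable_of_decay f (M : R) : continuous f ->
  (forall x, `|f x| <= M * (oneDsqr x)^-1) -> mu.-integrable setT (EFin \o f).
Proof.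
move=> cf fM; apply: (le_integrable _ _ _ (integrable_oneDsqrV M)) => //.
  by apply/measurable_EFinP; exact: continuous_measurable_fun.
by move=> x _ /=; rewrite lee_fin (le_trans (fM x)) // ler_norm.
Qed.

Lemma integrable_scale f (c : R) (D : set R) : measurable D ->
  mu.-integrable D (EFin \o f) -> mu.-integrable D (EFin \o (fun x => c * f x)).
Proof.
move=> mD fi; rewrite (_ : EFin \o _ = fun x => (c%:E * (EFin \o f) x)%E) //.
exact: integrableZl.
Qed.

Lemma integrable_add f g (D : set (measurableTypeR R)) : measurable D ->
  mu.-integrable D (EFin \o f) -> mu.-integrable D (EFin \o g) ->
  mu.-integrable D (EFin \o (fun x => f x + g x)).
Proof.
by move=> mD fi gi; exact: (integrableD mD fi gi).
Qed.

Lemma cvg_Rintegral_sym f : mu.-integrable setT (EFin \o f) ->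
  \int[mu]_(x in `[- n%:R, n%:R]) f x @[n --> \oo] --> \int[mu]_x f x.
Proof.
move=> fi; apply: fine_cvg; rewrite fineK; last exact: integrable_fin_num.
under eq_fun do rewrite integral_mkcond.
apply: (@dominated_cvg _ _ _ mu setT measurableT _ _ (fun x => `|(f x)%:E|%E)).
- move=> n; apply/(measurable_restrictT _ (measurable_itv _)).
  by apply: measurable_funTS; exact: (measurable_int mu).
- move=> x _; apply: cvg_near_cst; near=> n; rewrite patchE mem_set //=.
  by rewrite in_itv /= -ler_norml; near: n; exact: nbhs_infty_ger.
- by [].
- exact: integrable_abse.
- move=> n x _; rewrite patchE; case: ifPn => // _.
  by rewrite abse0.
Unshelve. all: by end_near.
Qed.

Lemma Rintegral_norm_le f (C A : R) : mu.-integrable setT (EFin \o f) ->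
  (forall b, A <= b -> `|\int[mu]_(x in `[- b, b]) f x| <= C) ->
  `|\int[mu]_x f x| <= C.
Proof.
move=> fi fC; apply: (cvgr_to_le (cvg_norm (cvg_Rintegral_sym fi))).
near=> n; apply: fC; near: n; exact: nbhs_infty_ger.
Unshelve. all: by end_near.
Qed.


(** Monotone convergence along [[-n, n]]. It serves where no pointwise majorant is at hand: for the
    transform itself, known only through its energies, and for the translated Cauchy kernel. *)
Lemma integrable_of_bounded f (C : R) : continuous f ->
  (forall b, 0 <= b -> \int[mu]_(x in `[- b, b]) `|f x| <= C) ->
  mu.-integrable setT (EFin \o f).
Proof.
move=> cf fC; have mf : measurable_fun [set: R] (fun x => (f x)%:E).
  by apply/measurable_EFinP; exact: continuous_measurable_fun.
have cnf : continuous (fun x => `|f x|).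
  by move=> x; apply: cvg_norm; exact: cf.
have mnf : measurable_fun [set: R] (fun x => `|(f x)%:E|%E).
  exact: measurableT_comp.
apply/integrableP; split => //.
have := @ge0_nondecreasing_set_cvg_integral _ (measurableTypeR R) R
  (fun n => `[(- n%:R : R), n%:R]%classic) (fun x : R => `|(f x)%:E|%E)
  (@lebesgue_measure R : {measure set _ -> \bar R}).
have -> : \bigcup_i `[(- i%:R : R), i%:R]%classic = [set: R].
  apply/seteqP; split => // x _ /=.
  have [n nx] : exists n : nat, `|x| <= n%:R.
    by exists (Num.truncn `|x|).+1; rewrite ltW // truncnS_gt.
  by exists n => //=; rewrite in_itv /= -ler_norml.
move=> H; apply: (@le_lt_trans _ _ C%:E); last exact: ltry.
apply: (cvge_to_le (H _ _ _ _)).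
- apply/nondecreasing_seqP => n; rewrite subsetEset; apply: subset_itv;
    by rewrite bnd_simp ?lerN2 ler_nat.
- by move=> i; exact: measurable_itv.
- by move=> i; exact: measurable_funTS.
- by move=> i x _; exact: abse_ge0.
apply: nearW => n; rewrite -[leLHS]fineK; last first.
  have := continuous_integrable_itv (- n%:R) n%:R cnf.
  exact: integrable_fin_num.
by rewrite lee_fin; apply: fC.
Qed.

End RealIntegral.

(** * Fourier integrals of rapidly decreasing functions *)

Section Wave.
Context {R : realType}.
Local Open Scope classical_set_scope.
Local Open Scope ring_scope.
Local Notation mu := (@lebesgue_measure R).
Implicit Types (v dv : R -> R) (th xi : R).

(** Decay of the function alone, without derivatives, so that a triangle times a bounded continuous
    function qualifies. The factor [(1 + x^2)^-1] makes each bound an integrable majorant. *)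
Definition rapid v := continuous v /\
  forall k, exists M : R, forall x, `|x ^+ k * v x| <= M * (oneDsqr x)^-1.

Lemma rapidX v : rapid v -> rapid (fun x => x * v x).
Proof.
move=> [cv dv]; split=> [x|k].
  by apply: cvgM; [exact: cvg_id|exact: cv].
have [M HM] := dv k.+1; exists M => x.
by rewrite mulrA -exprSr.
Qed.

Lemma rapid_decay v : rapid v ->
  exists M : R, forall x, `|v x| <= M * (oneDsqr x)^-1.
Proof.
by move=> [_ /(_ 0)[M HM]]; exists M => x; have := HM x; rewrite expr0 mul1r.
Qed.

(** The shift [th] unites the cosine and sine transforms in one real family that is stable under
    differentiation: a derivative adds [pi / 2] to [th] and a factor [x] to [v]. *)
Definition wave th v xi : R := \int[mu]_x (cos (x * xi + th) * v x).

Lemma continuous_cosM v xi th : continuous v ->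
  continuous (fun x : R => cos (x * xi + th) * v x).
Proof.
move=> cv x; apply: cvgM; last exact: cv.
apply: (@continuous_comp _ _ _ (fun x : R => x * xi + th)); last exact: continuous_cos.
by apply: cvgD; [apply: cvgM; [exact: cvg_id|exact: cvg_cst]|exact: cvg_cst].
Qed.

Lemma integrable_wave th v xi : rapid v ->
  mu.-integrable setT (EFin \o (fun x : R => cos (x * xi + th) * v x)).
Proof.
move=> rv; have [M HM] := rapid_decay rv.
apply: (@integrable_of_decay _ _ M).
  by apply: continuous_cosM; case: rv.
by move=> x; apply: le_trans (HM x); exact: norm_cosM_le.
Qed.

Lemma der_wave th v xi : rapid v ->
  is_derive xi 1 (wave th v) (wave (th + pi / 2) (fun x => x * v x) xi).
Proof.
move=> rv; have rxv := rapidX rv; have [M HM] := rapid_decay rxv.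
pose f (y x : R) := cos (x * y + th) * v x.
have Hf (y x : R) : is_derive y 1 (f^~ x) (cos (x * y + (th + pi / 2)) * (x * v x)).
  by rewrite /f; der; rewrite /= addrA cosDpihalf; ring.
have d1 (y x : R) : partial1of2 f y x = cos (x * y + (th + pi / 2)) * (x * v x).
  by rewrite partial1of2E; have [] := Hf y x.
have Ixi : [set` `](xi - 1), (xi + 1)[] xi.
  by rewrite /= in_itv /= ltrBlDr ltrDl ltr01.
pose G (x : R) := M * (oneDsqr x)^-1.
have G0 x : 0 <= G x by exact: le_trans (HM x).
have I0 y : [set` `](xi - 1), (xi + 1)[] y -> mu.-integrable setT (EFin \o f y).
  by move=> _; exact: integrable_wave.
have D0 (y x : R) : [set` `](xi - 1), (xi + 1)[] y -> setT x -> derivable (f^~ x) y 1.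
  by move=> _ _; have [] := Hf y x.
have B0 (y x : R) : [set` `](xi - 1), (xi + 1)[] y -> setT x ->
    `|partial1of2 f y x| <= G x.
  by move=> _ _; rewrite d1; exact: le_trans (norm_cosM_le _ _) (HM x).
apply: DeriveDef.
  exact: (derivable_under_integral measurableT Ixi I0 D0 G0 (integrable_oneDsqrV M) B0).
rewrite -derive1E.
rewrite (differentiation_under_integral measurableT Ixi I0 D0 G0 (integrable_oneDsqrV M) B0).
by apply: eq_Rintegral => x _; rewrite d1.
Qed.

(** The derivative of [cos (x * xi + th) * v x] has integral zero: over [[-b, b]] it is a difference
    of boundary values, each at most [M / b]. *)
Lemma wave_by_parts th v dv xi : rapid v -> rapid dv ->
  (forall x : R, is_derive x 1 v (dv x)) ->
  xi * wave (th + pi / 2) v xi = - wave th dv xi.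
Proof.
move=> rv rdv Hv; have [cv _] := rv; have [cdv _] := rdv.
have [M HM] := rapid_decay rv.
pose f (x : R) := cos (x * xi + th) * dv x + xi * (cos (x * xi + (th + pi / 2)) * v x).
have cf : continuous f.
  move=> x; have c1 := @continuous_cosM _ xi th cdv x.
  have c2 := @continuous_cosM _ xi (th + pi / 2) cv x.
  exact: (cvgD c1 (cvgM (cvg_cst xi) c2)).
have i1 := integrable_wave th xi rdv.
have i2 := integrable_wave (th + pi / 2) xi rv.
have i3 : mu.-integrable setT
    (EFin \o (fun x : R => xi * (cos (x * xi + (th + pi / 2)) * v x))).
  rewrite (_ : EFin \o _ =
    fun x => (xi%:E * (EFin \o (fun x : R => cos (x * xi + (th + pi / 2)) * v x)%R) x)%E) //.
  exact: integrableZl.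
have If : mu.-integrable setT (EFin \o f).
  rewrite (_ : EFin \o f = fun x => ((cos (x * xi + th) * dv x)%R%:E +
    (xi * (cos (x * xi + (th + pi / 2)) * v x))%R%:E)%E) //.
  exact: integrableD.
have E : \int[mu]_x f x = wave th dv xi + xi * wave (th + pi / 2) v xi.
  by rewrite RintegralD // RintegralZl.
suff F0 : \int[mu]_x f x = 0 by apply/eqP; rewrite -addr_eq0 addrC -E F0.
apply/eqP; rewrite -normr_le0; apply/ler_addgt0Pl => e e0; rewrite addr0.
have M0 : 0 <= M.
  by have := le_trans (normr_ge0 _) (HM 0); rewrite /oneDsqr expr0n addr0 invr1 mulr1.
apply: (@Rintegral_norm_le _ _ _ (1 + 2 * M / e)) => // b bM.
have b1 : 1 <= b by apply: le_trans bM; rewrite lerDl divr_ge0 ?mulr_ge0 // ltW.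
have bM' : 2 * M / e <= b by apply: le_trans bM; rewrite lerDr.
have b0 : 0 < b by exact: lt_le_trans b1.
have HF (x : R) : is_derive x 1 (fun x => cos (x * xi + th) * v x) (f x).
  by have Hx := Hv x; der; rewrite /f /= addrA cosDpihalf; ring.
rewrite (Rintegral_derivative cf HF); last by rewrite ge0_cp // ltW.
apply: (le_trans (ler_normB _ _)).
have Mb y : y ^+ 2 = b ^+ 2 -> `|cos (y * xi + th) * v y| <= M / b.
  move=> yb; apply: (le_trans (norm_cosM_le _ _)); apply: (le_trans (HM y)).
  rewrite /oneDsqr yb ler_wpM2l // lef_pV2 ?posrE ?addr_gt0 ?exprn_gt0 //.
  by rewrite expr2; apply: (@le_trans _ _ (b * b)); [exact: ler_peMr (ltW b0) b1|rewrite lerDr].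
apply: (@le_trans _ _ (M / b + M / b)).
  by apply: lerD; apply: Mb => //; rewrite sqrrN.
by rewrite -mulr2n -mulr_natl mulrA ler_pdivrMr // [e * b]mulrC -ler_pdivrMr.
Qed.

(** The left side is [xi] times the derivative of the transform. Integration by parts for [x v],
    whose derivative is [v + x v'], is what brings in the norm of [x v']. *)
Lemma wave_by_parts_der th v dv xi : rapid v -> rapid dv ->
  (forall x : R, is_derive x 1 v (dv x)) ->
  xi * wave (th + pi / 2) (fun x => x * v x) xi =
    - wave th (fun x => x * dv x) xi - wave th v xi.
Proof.
move=> rv rdv Hv.
have rxv := rapidX rv; have rxdv := rapidX rdv.
have H1 : forall x : R, is_derive x 1 (fun x => x * v x) (v x + x * dv x).
  by move=> x; have Hx := Hv x; der; rewrite mul1r.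
have rd : rapid (fun x => v x + x * dv x).
  have [cv d1] := rv; have [cxdv d2] := rxdv; split=> [x|k].
    by apply: cvgD; [exact: cv|exact: cxdv].
  have [M1 HM1] := d1 k; have [M2 HM2] := d2 k; exists (M1 + M2) => x.
  by rewrite mulrDr mulrDl (le_trans (ler_normD _ _)) // lerD.
rewrite (wave_by_parts _ _ rxv rd H1) -opprD; congr (- _).
rewrite -RintegralD //; [|exact: integrable_wave|exact: integrable_wave].
by apply: eq_Rintegral => x _; rewrite mulrDr addrC.
Qed.

End Wave.

(** * Joint measurability and exchange of integrals on the line *)

Section Fubini.
Context {R : realType}.
Local Open Scope classical_set_scope.
Local Open Scope ring_scope.
Local Notation mu := (@lebesgue_measure R).
Implicit Types (p q : R -> R) (f : R -> R -> R).

Definition jointly_measurable f := measurable_fun setT (fun z : R * R => f z.1 z.2).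

Lemma jointly_measurable_row f x : jointly_measurable f -> measurable_fun setT (f x).
Proof.
move=> mf; apply: (measurableT_comp mf (g := fun y => (x, y))).
exact: measurable_pair1.
Qed.

Lemma jointly_measurable_swap f :
  jointly_measurable f -> jointly_measurable (fun x y => f y x).
Proof.
move=> mf; apply: (measurableT_comp mf (g := fun z : R * R => (z.2, z.1))).
exact: measurable_swap.
Qed.

Lemma jointly_measurable_fst p : measurable_fun setT p ->
  jointly_measurable (fun x _ => p x).
Proof. by move=> mp; exact: (measurableT_comp mp measurable_fst). Qed.

Lemma jointly_measurable_snd p : measurable_fun setT p ->
  jointly_measurable (fun _ y => p y).
Proof. by move=> mp; exact: (measurableT_comp mp measurable_snd). Qed.

Lemma jointly_measurable_cos (th : R) : jointly_measurable (fun x y => cos (x * y + th)).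
Proof.
apply: (measurableT_comp (f := @cos R)).
  by apply: continuous_measurable_fun; exact: continuous_cos.
apply: measurable_funD; last exact: measurable_cst.
by apply: measurable_funM; [exact: measurable_fst|exact: measurable_snd].
Qed.

Lemma integrable_row f p q x : jointly_measurable f ->
  mu.-integrable setT (EFin \o q) -> (forall x y, `|f x y| <= p x * q y) ->
  mu.-integrable setT (EFin \o f x).
Proof.
move=> mf iq fpq.
have ipq : mu.-integrable setT (EFin \o (fun y => p x * q y)).
  rewrite (_ : EFin \o _ = fun y => ((p x)%:E * (EFin \o q) y)%E) //.
  exact: integrableZl.
apply: (le_integrable _ _ _ ipq) => //.
  by apply/measurable_EFinP; exact: jointly_measurable_row.
by move=> y _ /=; rewrite lee_fin (le_trans (fpq x y)) // ler_norm.
Qed.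

Lemma Rintegral_swap f p q : jointly_measurable f ->
  mu.-integrable setT (EFin \o p) -> mu.-integrable setT (EFin \o q) ->
  (forall x, 0 <= p x) -> (forall y, 0 <= q y) ->
  (forall x y, `|f x y| <= p x * q y) ->
  \int[mu]_x (\int[mu]_y f x y) = \int[mu]_y (\int[mu]_x f x y).
Proof.
move=> mf ip iq p0 q0 fpq.
have E1 x : (\int[mu]_y (f x y)%:E)%E = (\int[mu]_y f x y)%:E.
  by rewrite /Rintegral fineK //; apply: integrable_fin_num => //;
    exact: (integrable_row _ mf iq fpq).
have E2 y : (\int[mu]_x (f x y)%:E)%E = (\int[mu]_x f x y)%:E.
  rewrite /Rintegral fineK //; apply: integrable_fin_num => //.
  apply: (integrable_row _ (jointly_measurable_swap mf) ip) => a b.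
  by rewrite mulrC; exact: fpq.
rewrite /Rintegral; congr fine.
under eq_integral do rewrite -E1.
under [RHS]eq_integral do rewrite -E2.
have := @Fubini _ _ _ _ R mu mu (fun z : R * R => (f z.1 z.2)%:E); apply.
apply/integrable12ltyP => /=; first exact/measurable_EFinP.
have mp : measurable_fun setT p by apply/measurable_EFinP; exact: measurable_int ip.
have mq : measurable_fun setT q by apply/measurable_EFinP; exact: measurable_int iq.
pose Q := \int[mu]_y q y.
have EQ : (\int[mu]_y (q y)%:E)%E = Q%:E.
  by rewrite /Q /Rintegral fineK //; apply: integrable_fin_num.
have ipQ : mu.-integrable setT (EFin \o (fun x => p x * Q)).
  rewrite (_ : EFin \o _ = fun x => ((EFin \o p) x * Q%:E)%E) //.
  exact: integrableZr.
have mpQ := measurable_int _ ipQ.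
apply: (@le_lt_trans _ _ (\int[mu]_x (p x * Q)%:E)%E); last first.
  have := integrable_fin_num measurableT ipQ.
  by rewrite fin_numElt => /andP[].
apply: ge0_le_integral => //.
- by move=> x _; apply: integral_ge0 => y _; rewrite lee_fin.
- have := @measurable_fun_fubini_tonelli_F _ _ _ _ R mu
    (fun z : R * R => `|f z.1 z.2|%:E); apply => //=.
  by apply/measurable_EFinP; exact: measurableT_comp.
- move=> x _; rewrite EFinM -EQ -ge0_integralZl //; last 3 first.
    by apply/measurable_EFinP.
    by move=> y _; rewrite lee_fin.
    by rewrite lee_fin.
  apply: ge0_le_integral => //.
  + apply/measurable_EFinP; apply: measurableT_comp => //.
    exact: jointly_measurable_row.
  + by apply/measurable_EFinP; exact: measurable_funM.
  + by move=> y _; rewrite -EFinM lee_fin.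
Qed.

End Fubini.

(** * Bessel's inequality *)

Section Bessel.
Context {R : realType}.
Local Open Scope classical_set_scope.
Local Open Scope ring_scope.
Local Notation mu := (@lebesgue_measure R).

(** * The triangle weight, its transform, and the Cauchy kernel *)

Section Triangle.
Variable L : R.
Hypothesis L0 : 0 < L.

(** A continuous cutoff: its transform, a Fejer kernel, decays like [1 / (L z^2)] and is integrable
    uniformly in [L], which a sharp cutoff would not give. *)
Definition tri (x : R) : R := Num.max 0 (1 - `|x| / L).

Lemma tri_ge0 x : 0 <= tri x.
Proof. by rewrite le_max lexx. Qed.

Lemma tri_le1 x : tri x <= 1.
Proof. by rewrite ge_max ler01 gerBl divr_ge0 // ltW. Qed.

Lemma tri_out x : L <= `|x| -> tri x = 0.
Proof. by move=> Lx; apply/max_idPl; rewrite subr_le0 ler_pdivlMr // mul1r. Qed.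

Lemma tri_pos x : 0 <= x <= L -> tri x = 1 - x / L.
Proof.
move=> /andP[x0 xL]; rewrite /tri (ger0_norm x0); apply/max_idPr.
by rewrite subr_ge0 ler_pdivrMr // mul1r.
Qed.

Lemma tri_neg x : - L <= x <= 0 -> tri x = 1 + x / L.
Proof.
move=> /andP[xL x0]; rewrite /tri (ler0_norm x0) mulNr opprK; apply/max_idPr.
by rewrite -lerBlDl sub0r ler_pdivlMr // mulN1r.
Qed.

Lemma tri_half x : `|x| <= L / 2 -> 2^-1 <= tri x.
Proof.
move=> xL; rewrite le_max; apply/orP; right.
have : `|x| / L <= 2^-1 by rewrite ler_pdivrMr // mulrC.
by lra.
Qed.

Lemma continuous_tri : continuous tri.
Proof.
move=> x; apply: (@continuous_max _ _ (cst 0) (fun x : R => 1 - `|x| / L)).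
  exact: cst_continuous.
apply: cvgB; first exact: cvg_cst.
by apply: cvgM; [apply: cvg_norm; exact: cvg_id|exact: cvg_cst].
Qed.

Lemma rapid_triM (u : R -> R) (B : R) : continuous u -> (forall x, `|u x| <= B) ->
  rapid (fun x => tri x * u x).
Proof.
move=> cu uB; have B0 : 0 <= B := le_trans (normr_ge0 _) (uB 0).
split=> [x|k]; first by apply: cvgM; [exact: continuous_tri|exact: cu].
exists (L ^+ k * B * (1 + L ^+ 2)) => x.
have M0 : 0 <= L ^+ k * B by rewrite mulr_ge0 // exprn_ge0 // ltW.
have [Lx|xL] := leP L `|x|.
  rewrite tri_out // mul0r mulr0 normr0 divr_ge0 ?oneDsqr_ge0 //.
  by rewrite mulr_ge0 // addr_ge0 // sqr_ge0.
rewrite ler_pdivlMr ?oneDsqr_gt0 // normrM normrX.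
apply: ler_pM; [by rewrite mulr_ge0 // exprn_ge0|exact: oneDsqr_ge0| |].
  apply: ler_pM; [exact: exprn_ge0|exact: normr_ge0| |].
    by apply: lerXn2r; rewrite ?nnegrE // ltW.
  rewrite normrM (ger0_norm (tri_ge0 x)) -[leRHS]mul1r.
  by apply: ler_pM; rewrite ?tri_ge0 ?tri_le1.
rewrite /oneDsqr lerD2l -[x ^+ 2](real_normK (num_real x)).
by apply: lerXn2r; rewrite ?nnegrE // ltW.
Qed.

Lemma rapid_tri : rapid tri.
Proof.
have := @rapid_triM (cst 1) 1 (@cst_continuous _ _ _) _.
under [X in rapid X]eq_fun do rewrite mulr1.
by apply => x; rewrite normr1.
Qed.

(** The transform is at most [2 L] trivially and at most [4 / (L z^2)] by explicit primitives on the
    two halves. Multiplied by [1 + L^2 z^2] this gives [2 L + 4 L]. *)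
Lemma wave_tri_le ph z : `|wave ph tri z| <= 6 * (L * (oneDsqr (L * z))^-1).
Proof.
pose f (x : R) := cos (x * z + ph) * tri x.
have cf : continuous f by apply: continuous_cosM; exact: continuous_tri.
apply: (@Rintegral_norm_le _ _ _ L); first exact/integrable_wave/rapid_tri.
move=> b Lb; have b0 : 0 <= b by apply: le_trans Lb; exact: ltW.
have [F [HF FE]] := continuous_primitive cf.
rewrite -FE ?ge0_cp //.
have f0 a c : a <= c -> (forall x, a <= x <= c -> L <= `|x|) -> F c - F a = 0.
  move=> ac Lx; apply/eqP; rewrite -normr_le0 -(subrr (0 : R)).
  notypeclasses refine (@ler_norm_increment _ F f (fun=> 0) (fun=> 0) a c ac
    (fun x _ => HF x) _ _) => x xac; first exact: derC.
  by rewrite /f tri_out ?mulr0 ?normr0 // Lx.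
have E : F b - F (- b) = (F L - F 0) + (F 0 - F (- L)).
  have e1 : F b - F L = 0.
    by apply: f0 => // x /andP[Lx _]; rewrite (le_trans Lx) // ler_norm.
  have e2 : F (- L) - F (- b) = 0.
    apply: f0 => [|x /andP[_ xL]]; first by rewrite lerN2.
    by rewrite -normrN (le_trans _ (ler_norm _)) // lerNr.
  have -> : F b - F (- b) = (F b - F L) + (F L - F 0) + (F 0 - F (- L)) +
    (F (- L) - F (- b)) by ring.
  by rewrite e1 e2; ring.
have B1 : `|F b - F (- b)| <= 2 * L.
  have -> : F b - F (- b) = F L - F (- L) by rewrite E; ring.
  have -> : 2 * L = L - - L by ring.
  notypeclasses refine (@ler_norm_increment _ F f (fun x => x) (fun=> 1) (- L) L _
    (fun x _ => HF x) (fun x _ => derid x) _) => [|x _].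
    by rewrite ge0_cp // ltW.
  apply: (le_trans (norm_cosM_le _ _)).
  by rewrite ger0_norm ?tri_ge0 // tri_le1.
have eqF (G dG : R -> R) a c : a <= c -> (forall x : R, is_derive x 1 G (dG x)) ->
    (forall x, a <= x <= c -> dG x = f x) -> F c - F a = G c - G a.
  move=> ac HG GF; apply/eqP; rewrite -subr_eq0 -normr_le0 -(subrr (0 : R)).
  have -> : F c - F a - (G c - G a) = (F c - G c) - (F a - G a) by ring.
  notypeclasses refine (@ler_norm_increment _ (fun x => F x - G x)
    (fun x => f x - dG x) (fun=> 0) (fun=> 0) a c ac _ _ _) => x xac.
  - by have H1 := HF x; have H2 := HG x; der.
  - exact: derC.
  - by rewrite GF // subrr normr0.
have B2 : z != 0 -> `|F b - F (- b)| <= 4 / (L * z ^+ 2).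
  move=> z0; rewrite E.
  (* The sine terms vanish at [L] and [- L] and cancel between the two halves at 0, so only the
     cosines over [L * z ^+ 2] remain. *)
  have HG1 (x : R) : is_derive x 1 (fun x => (1 - x / L) * (sin (x * z + ph) / z) -
      cos (x * z + ph) / (L * z ^+ 2)) (cos (x * z + ph) * (1 - x / L)).
    by der; rewrite /=; field; rewrite z0 lt0r_neq0.
  have HG2 (x : R) : is_derive x 1 (fun x => (1 + x / L) * (sin (x * z + ph) / z) +
      cos (x * z + ph) / (L * z ^+ 2)) (cos (x * z + ph) * (1 + x / L)).
    by der; rewrite /=; field; rewrite z0 lt0r_neq0.
  have NL0 : - L <= 0 by rewrite oppr_le0 ltW.
  have -> := eqF _ _ _ _ (ltW L0) HG1; last by move=> x /tri_pos <-.
  have -> := eqF _ _ _ _ NL0 HG2; last by move=> x /tri_neg <-.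
  rewrite /=; set c1 := cos (L * z + ph); set c2 := cos (- L * z + ph).
  rewrite [X in `|X|](_ : _ = (2 * cos (0 * z + ph) - c1 - c2) / (L * z ^+ 2)); last first.
    by field; rewrite z0 lt0r_neq0.
  rewrite normrM [X in _ * X]ger0_norm; last first.
    by rewrite invr_ge0 mulr_ge0 ?sqr_ge0 // ltW.
  apply: ler_wpM2r; first by rewrite invr_ge0 mulr_ge0 ?sqr_ge0 // ltW.
  have h0 := cos_le1 (0 * z + ph); have h0' := cos_geN1 (0 * z + ph).
  have h1 : c1 <= 1 := cos_le1 _; have h1' : -1 <= c1 := cos_geN1 _.
  have h2 : c2 <= 1 := cos_le1 _; have h2' : -1 <= c2 := cos_geN1 _.
  by rewrite ler_norml; lra.
rewrite mulrA ler_pdivlMr ?oneDsqr_gt0 // /oneDsqr mulrDr mulr1.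
have [->|z0] := eqVneq z 0.
  by rewrite mulr0 expr0n mulr0 addr0 (le_trans B1) //; move: L0; lra.
have z2 : 0 < L * z ^+ 2 by rewrite mulr_gt0 // exprn_even_gt0.
have := B2 z0; rewrite ler_pdivlMr // => B2'.
have -> : `|F b - F (- b)| * (L * z) ^+ 2 = L * (`|F b - F (- b)| * (L * z ^+ 2)) by ring.
have : L * (`|F b - F (- b)| * (L * z ^+ 2)) <= L * 4 by rewrite ler_pM2l.
lra.
Qed.

(** Derivative of [atan (L z)]: its integral does not see [L], which keeps Bessel's inequality
    uniform in the truncation. *)
Definition cauchy_kernel (z : R) : R := L * (oneDsqr (L * z))^-1.

Lemma cauchy_kernel_ge0 z : 0 <= cauchy_kernel z.
Proof. by rewrite divr_ge0 ?oneDsqr_ge0 // ltW. Qed.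

Lemma continuous_cauchy_kernel : continuous cauchy_kernel.
Proof.
move=> z; apply: cvgM; first exact: cvg_cst.
apply: (@continuous_comp _ _ _ (fun z => L * z) (fun z => (oneDsqr z)^-1)).
  by apply: cvgM; [exact: cvg_cst|exact: cvg_id].
exact: continuous_oneDsqrV.
Qed.

Lemma cauchy_kernelN z : cauchy_kernel (- z) = cauchy_kernel z.
Proof. by rewrite /cauchy_kernel /oneDsqr mulrN sqrrN. Qed.

Lemma integral_cauchy_kernel (c : R) :
  (\int[mu]_y (cauchy_kernel (y + c))%:E <= pi%:E)%E.
Proof.
pose f y := cauchy_kernel (y + c).
have cf : continuous f.
  move=> y; apply: (@continuous_comp _ _ _ (fun y : R => y + c)).
    by apply: cvgD; [exact: cvg_id|exact: cvg_cst].
  exact: continuous_cauchy_kernel.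
have HF (y : R) : is_derive y 1 (fun y => atan (L * (y + c))) (f y).
  have Ha : is_derive (L * (y + c)) 1 (@atan R) (1 + (L * (y + c)) ^+ 2)^-1.
    exact: is_derive1_atan.
  have Hl : is_derive y 1 (fun y => L * (y + c)) L.
    by der; rewrite mul0r add0r addr0 mulr1.
  have Hc := @der_comp _ (@atan R) (fun y => L * (y + c)) y _ _ Ha Hl.
  by der; rewrite /f /cauchy_kernel /oneDsqr mulrC.
have Ib b : 0 <= b -> `|\int[mu]_(x in `[- b, b]) f x| <= pi.
  move=> b0; rewrite (Rintegral_derivative cf HF); last by rewrite ge0_cp.
  have := atan_ltpi2 (L * (b + c)); have := atan_gtNpi2 (L * (b + c)).
  have := atan_ltpi2 (L * (- b + c)); have := atan_gtNpi2 (L * (- b + c)).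
  by rewrite ler_norml; lra.
have If : mu.-integrable setT (EFin \o f).
  apply: (@integrable_of_bounded _ _ pi) => // b b0.
  have -> : \int[mu]_(x in `[- b, b]) `|f x| = \int[mu]_(x in `[- b, b]) f x.
    by apply: eq_Rintegral => x _; rewrite ger0_norm ?cauchy_kernel_ge0.
  by apply: le_trans (Ib _ b0); exact: ler_norm.
have := Rintegral_norm_le If Ib => /(le_trans (ler_norm _)).
by rewrite -lee_fin /Rintegral fineK //; exact: integrable_fin_num.
Qed.

End Triangle.

Lemma wave_bounded th (v : R -> R) : rapid v ->
  exists B : R, forall xi, `|wave th v xi| <= B.
Proof.
move=> rv; have [M HM] := rapid_decay rv.
exists (\int[mu]_x (M * (oneDsqr x)^-1)) => xi.
have iw := integrable_wave th xi rv.
apply: (le_trans (le_normr_Rintegral _ iw)) => //.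
apply: le_Rintegral => //; first exact: integrable_norm.
- exact: integrable_oneDsqrV.
- by move=> x _; apply: le_trans (HM x); exact: norm_cosM_le.
Qed.

Lemma continuous_of_der (f df : R -> R) :
  (forall x : R, is_derive x 1 f (df x)) -> continuous f.
Proof.
move=> Hf x; apply: differentiable_continuous; apply/derivable1_diffP.
by have [] := Hf x.
Qed.

Lemma continuous_wave th (v : R -> R) : rapid v -> continuous (wave th v).
Proof. by move=> rv; apply: continuous_of_der => xi; exact: der_wave. Qed.

Lemma rapid_measurable (v : R -> R) : rapid v -> measurable_fun setT v.
Proof. by move=> [cv _]; exact: continuous_measurable_fun. Qed.

Lemma rapid_integrable (v : R -> R) : rapid v -> mu.-integrable setT (EFin \o v).
Proof.
move=> rv; have [M HM] := rapid_decay rv; have [cv _] := rv.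
exact: integrable_of_decay HM.
Qed.

Lemma rapid_norm (v : R -> R) : rapid v -> rapid (fun x => `|v x|).
Proof.
move=> [cv dv]; split=> [x|k]; first by apply: cvg_norm; exact: cv.
have [M HM] := dv k; exists M => x.
by rewrite normrM normr_id -normrM.
Qed.

Lemma rapid_sqr (v : R -> R) : rapid v -> rapid (fun x => v x ^+ 2).
Proof.
move=> rv; have [cv dv] := rv; split=> [x|k].
  by apply: cvgM; exact: cv.
have [M HM] := dv k; have [M0 HM0] := dv 0.
exists (M * M0) => x.
have H0 := HM0 x; rewrite expr0 mul1r in H0.
rewrite expr2 mulrA normrM.
have i1 : (oneDsqr x)^-1 <= 1 := oneDsqrV_le1 x.
have i0 : 0 <= (oneDsqr x)^-1 by rewrite invr_ge0 oneDsqr_ge0.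
have m0 : 0 <= M0.
  by have := le_trans (normr_ge0 _) H0; rewrite pmulr_lge0 ?invr_gt0 ?oneDsqr_gt0.
apply: (@le_trans _ _ (M * (oneDsqr x)^-1 * M0)); last by rewrite mulrAC.
apply: ler_pM => //; apply: (le_trans H0); exact: ler_piMr.
Qed.

(** Comes from writing a product of cosines as a half-sum: [th] cancels in the difference of the
    arguments and doubles in their sum. *)
Let kernel (L th x y : R) : R :=
  (wave 0 (tri L) (x - y) + wave (2 * th) (tri L) (x + y)) / 2.

Let kernel_bound (L x y : R) : R :=
  3 * (cauchy_kernel L (y - x) + cauchy_kernel L (y + x)).

Let kernel_le L th x y : 0 < L -> `|kernel L th x y| <= kernel_bound L x y.
Proof.
move=> L0; have h1 := wave_tri_le L0 0 (x - y).
have h2 := wave_tri_le L0 (2 * th) (x + y).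
rewrite -/(cauchy_kernel L _) in h1; rewrite -/(cauchy_kernel L _) in h2.
rewrite /kernel normrM [X in _ * X]ger0_norm ?invr_ge0 // ler_pdivrMr //.
apply: (le_trans (ler_normD _ _)).
rewrite /kernel_bound -(cauchy_kernelN L (y - x)) opprB (addrC y).
move: h1 h2; lra.
Qed.

Let kernelE L th x y : 0 < L ->
  \int[mu]_xi (tri L xi * (cos (xi * x + th) * cos (xi * y + th))) = kernel L th x y.
Proof.
move=> L0; rewrite /kernel -RintegralD //; last 2 first.
  - exact/integrable_wave/rapid_tri.
  - exact/integrable_wave/rapid_tri.
rewrite -RintegralZr //; last first.
  have i1 := integrable_wave 0 (x - y) (rapid_tri L0).
  have i2 := integrable_wave (2 * th) (x + y) (rapid_tri L0).
  exact: (integrableD measurableT i1 i2).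
apply: eq_Rintegral => xi _.
have -> : xi * (x - y) + 0 = (xi * x + th) - (xi * y + th) by ring.
have -> : xi * (x + y) + 2 * th = (xi * x + th) + (xi * y + th) by ring.
by rewrite (cosB (xi * x + th)) (cosD (xi * x + th) (xi * y + th)); field.
Qed.

Lemma waveC th (v : R -> R) xi :
  wave th v xi = \int[mu]_x (cos (xi * x + th) * v x).
Proof. by apply: eq_Rintegral => x _; rewrite [x * xi]mulrC. Qed.

Lemma integrable_waveC th (v : R -> R) xi : rapid v ->
  mu.-integrable setT (EFin \o (fun x => cos (xi * x + th) * v x)).
Proof.
move=> rv; have := integrable_wave th xi rv.
rewrite (_ : (fun x => cos (x * xi + th) * v x) =
             (fun x => cos (xi * x + th) * v x)) //.
by apply/funext => x; rewrite [x * xi]mulrC.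
Qed.

Lemma rapid_tri_wave L th (v : R -> R) : 0 < L -> rapid v ->
  rapid (fun xi => tri L xi * wave th v xi).
Proof.
move=> L0 rv; have [B HB] := @wave_bounded th v rv.
exact: (rapid_triM L0 (@continuous_wave th v rv) HB).
Qed.

(** The square is expanded one factor at a time, here and in [wave_wave], so that each exchange
    concerns two variables and is dominated by a product. *)
Lemma weighted_wave_sqr L th (v : R -> R) : 0 < L -> rapid v ->
  \int[mu]_xi (tri L xi * wave th v xi ^+ 2) =
  \int[mu]_x (v x * wave th (fun xi => tri L xi * wave th v xi) x).
Proof.
move=> L0 rv; have rwS := rapid_tri_wave th L0 rv.
pose f (xi x : R) := (tri L xi * wave th v xi) * (cos (xi * x + th) * v x).
have mf : jointly_measurable f.
  apply: measurable_funM.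
    exact: (jointly_measurable_fst (rapid_measurable rwS)).
  apply: measurable_funM; first exact: jointly_measurable_cos.
  exact: (jointly_measurable_snd (rapid_measurable rv)).
transitivity (\int[mu]_xi (\int[mu]_x f xi x)).
  apply: eq_Rintegral => xi _; rewrite /f RintegralZl //.
    by rewrite expr2 mulrA -waveC.
  exact: integrable_waveC.
rewrite (Rintegral_swap mf (rapid_integrable (rapid_norm rwS))
  (rapid_integrable (rapid_norm rv))) //; last first.
  by move=> x y; rewrite /f normrM ler_wpM2l // norm_cosM_le.
apply: eq_Rintegral => x _; rewrite -RintegralZl //; last exact: integrable_wave.
by apply: eq_Rintegral => xi _; rewrite /f; ring.
Qed.

Lemma wave_wave L th (v : R -> R) x : 0 < L -> rapid v ->
  v x * wave th (fun xi => tri L xi * wave th v xi) x =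
  \int[mu]_y (v x * v y * kernel L th x y).
Proof.
move=> L0 rv; have rwS := rapid_tri_wave th L0 rv; have rt := rapid_tri L0.
pose g (xi y : R) := (tri L xi * (cos (xi * x + th) * v x)) * (cos (xi * y + th) * v y).
have rwc : rapid (fun xi => tri L xi * (cos (xi * x + th) * v x)).
  apply: (@rapid_triM _ L0 _ `|v x|) => [xi|xi]; last exact: norm_cosM_le.
  apply: cvgM; last exact: cvg_cst.
  apply: (@continuous_comp _ _ _ (fun xi : R => xi * x + th)); last exact: continuous_cos.
  by apply: cvgD; [apply: cvgM; [exact: cvg_id|exact: cvg_cst]|exact: cvg_cst].
have mg : jointly_measurable g.
  apply: measurable_funM.
    exact: (jointly_measurable_fst (rapid_measurable rwc)).
  apply: measurable_funM; first exact: jointly_measurable_cos.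
  exact: (jointly_measurable_snd (rapid_measurable rv)).
transitivity (\int[mu]_xi (\int[mu]_y g xi y)).
  rewrite -RintegralZl //; last exact: integrable_wave.
  apply: eq_Rintegral => xi _; rewrite /g RintegralZl //.
    by rewrite -waveC; ring.
  exact: integrable_waveC.
rewrite (Rintegral_swap mg (rapid_integrable (rapid_norm rwc))
  (rapid_integrable (rapid_norm rv))) //; last first.
  by move=> xi y; rewrite /g normrM ler_wpM2l // norm_cosM_le.
apply: eq_Rintegral => y _; rewrite -kernelE // -RintegralZl //; last first.
  have := @rapid_triM _ L0 (fun xi => cos (xi * x + th) * cos (xi * y + th)) 1.
  move=> rr; apply/rapid_integrable/rr => xi.
    apply: cvgM; apply: (@continuous_comp _ _ _ (fun xi : R => xi * _ + th));
      try exact: continuous_cos;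
      by apply: cvgD; [apply: cvgM; [exact: cvg_id|exact: cvg_cst]|exact: cvg_cst].
  apply: (le_trans (norm_cosM_le _ _)).
  by rewrite ler_norml cos_geN1 cos_le1.
by apply: eq_Rintegral => xi _; rewrite /g; ring.
Qed.

(* Schur's test: AM-GM on [v x * v y], and the kernel has bounded integral in
   each variable. *)
Lemma weighted_bessel L th (v : R -> R) : 0 < L -> rapid v ->
  \int[mu]_xi (tri L xi * wave th v xi ^+ 2) <= 6 * pi * \int[mu]_x v x ^+ 2.
Proof.
move=> L0 rv; rewrite weighted_wave_sqr //.
have rwS := rapid_tri_wave th L0 rv; set H := wave th _.
have [B HB] := @wave_bounded th _ rwS.
have cH : continuous H := @continuous_wave th _ rwS.
have [cv _] := rv; have mv := rapid_measurable rv.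
have rv2 := rapid_sqr rv.
have mH : measurable_fun setT H by exact: continuous_measurable_fun.
have mvH : measurable_fun setT (fun x => v x * H x) by exact: measurable_funM.
pose V := \int[mu]_x v x ^+ 2.
have EV : (\int[mu]_x (v x ^+ 2)%:E)%E = V%:E.
  by rewrite /V /Rintegral fineK //; apply: integrable_fin_num => //; exact: rapid_integrable.
have V0 : 0 <= V by apply: Rintegral_ge0 => x _; exact: sqr_ge0.
(* [A x y + A y x] dominates [|v x * v y * kernel L th x y|], and by Tonelli both terms have the
   same double integral, at most [3 * pi * V]. *)
pose A (x y : R) := 2^-1 * v x ^+ 2 * kernel_bound L x y.
have kb0 x y : 0 <= kernel_bound L x y.
  by rewrite mulr_ge0 // addr_ge0 // cauchy_kernel_ge0.
have kbC x y : kernel_bound L x y = kernel_bound L y x.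
  by rewrite /kernel_bound -(cauchy_kernelN L (y - x)) opprB (addrC y).
have A0 x y : 0 <= A x y.
  by apply: mulr_ge0 => //; apply: mulr_ge0; [rewrite invr_ge0|exact: sqr_ge0].
have mck : measurable_fun setT (cauchy_kernel L).
  by apply: continuous_measurable_fun; exact: continuous_cauchy_kernel.
have mkb : jointly_measurable (kernel_bound L).
  apply: measurable_funM => //; apply: measurable_funD.
    by apply: (measurableT_comp mck); exact: measurable_funB.
  by apply: (measurableT_comp mck); exact: measurable_funD.
have mA : jointly_measurable A.
  apply: measurable_funM => //; apply: (@jointly_measurable_fst _ (fun x => 2^-1 * v x ^+ 2)).
  by apply: measurable_funM => //; exact: rapid_measurable.
have mA' := jointly_measurable_swap mA.
have IA : (\int[mu]_x (\int[mu]_y (A x y)%:E) <= (3 * pi * V)%:E)%E.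
  have -> : (3 * pi * V)%:E = (\int[mu]_x ((3 * pi)%:E * (v x ^+ 2)%:E))%E.
    rewrite ge0_integralZl //; last 3 first.
    - by apply/measurable_EFinP; exact: rapid_measurable.
    - by move=> x _; rewrite lee_fin sqr_ge0.
    - by rewrite lee_fin mulr_ge0 // pi_ge0.
    by rewrite EV -EFinM.
  apply: ge0_le_integral => //.
  - by move=> x _; apply: integral_ge0 => y _; rewrite lee_fin.
  - have := @measurable_fun_fubini_tonelli_F _ _ _ _ R mu (fun z : R * R => (A z.1 z.2)%:E).
    by apply => /= [|z]; [exact/measurable_EFinP|rewrite lee_fin].
  - apply/measurable_EFinP; apply: measurable_funM => //.
    exact: rapid_measurable.
  move=> x _; rewrite /A.
  under eq_integral do rewrite EFinM.
  rewrite ge0_integralZl //; last 3 first.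
  - by apply/measurable_EFinP; exact: (jointly_measurable_row _ mkb).
  - by move=> y _; rewrite lee_fin.
  - by rewrite lee_fin mulr_ge0 ?sqr_ge0 ?invr_ge0.
  have K2 : (\int[mu]_y (kernel_bound L x y)%:E <= (6 * pi)%:E)%E.
    have mc (c : R) : measurable_fun setT (fun y : R => (cauchy_kernel L (y + c))%:E).
      apply/measurable_EFinP; apply: (measurableT_comp mck).
      exact: measurable_funD.
    have c0 (c : R) (y : R) : (0 <= (cauchy_kernel L (y + c))%:E)%E.
      by rewrite lee_fin cauchy_kernel_ge0.
    rewrite /kernel_bound; under eq_integral do rewrite EFinM.
    rewrite ge0_integralZl //; last 2 first.
    - apply/measurable_EFinP; apply: measurable_funD; apply/measurable_EFinP; exact: mc.
    - by move=> y _; rewrite lee_fin addr_ge0 // cauchy_kernel_ge0.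
    under eq_integral do rewrite EFinD.
    rewrite ge0_integralD //; [|exact: mc|exact: mc].
    have h1 := integral_cauchy_kernel L0 (- x); have h2 := integral_cauchy_kernel L0 x.
    apply: (@le_trans _ _ (3%:E * (pi%:E + pi%:E))%E).
      by apply: lee_wpmul2l; [rewrite lee_fin|exact: leeD].
    by rewrite -EFinD -EFinM lee_fin; lra.
  apply: (@le_trans _ _ ((2^-1 * v x ^+ 2)%:E * (6 * pi)%:E)%E).
    by apply: lee_wpmul2l => //; rewrite lee_fin mulr_ge0 ?sqr_ge0 ?invr_ge0.
  by rewrite -!EFinM lee_fin; apply: eq_ler; field.
have IvH : mu.-integrable setT (EFin \o (fun x => v x * H x)).
  have iB : mu.-integrable setT (EFin \o (fun x => B * `|v x|)).
    by apply: integrable_scale => //; exact/rapid_integrable/rapid_norm.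
  apply: (le_integrable _ _ _ iB) => //; first exact/measurable_EFinP.
  move=> x _ /=; rewrite lee_fin normrM mulrC; apply: (le_trans _ (ler_norm _)).
  by apply: ler_wpM2r.
have EvH : (\int[mu]_x (v x * H x)%:E)%E = (\int[mu]_x (v x * H x))%:E.
  by rewrite /Rintegral fineK //; exact: integrable_fin_num.
rewrite -lee_fin -EvH.
rewrite -/V; apply: (@le_trans _ _ (\int[mu]_x (\int[mu]_y (A x y + A y x)%:E))%E).
  apply: (le_trans (lee_abs _)); apply: (le_trans (le_abse_integral _ _ _)) => //.
    exact/measurable_EFinP.
  apply: ge0_le_integral => //.
  - by apply: measurableT_comp => //; exact/measurable_EFinP.
  - have := @measurable_fun_fubini_tonelli_F _ _ _ _ R mu
      (fun z : R * R => (A z.1 z.2 + A z.2 z.1)%:E).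
    apply => //= [|z]; last by rewrite lee_fin addr_ge0.
    by apply/measurable_EFinP; exact: measurable_funD.
  move=> x _; rewrite /= /H wave_wave //.
  have ck : continuous (kernel L th x).
    move=> y; apply: cvgM; last exact: cvg_cst.
    apply: cvgD.
      apply: (@continuous_comp _ _ _ (fun y : R => x - y)).
        by apply: cvgB; [exact: cvg_cst|exact: cvg_id].
      exact/continuous_wave/rapid_tri.
    apply: (@continuous_comp _ _ _ (fun y : R => x + y)).
      by apply: cvgD; [exact: cvg_cst|exact: cvg_id].
    exact/continuous_wave/rapid_tri.
  have mg : measurable_fun setT (fun y => v x * v y * kernel L th x y).
    apply: measurable_funM; last exact: continuous_measurable_fun.
    exact: measurable_funM.
  have ig : mu.-integrable setT (EFin \o (fun y => v x * v y * kernel L th x y)).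
    have iB : mu.-integrable setT (EFin \o (fun y => (`|v x| * (6 * L)) * `|v y|)).
      by apply: integrable_scale => //; exact/rapid_integrable/rapid_norm.
    apply: (le_integrable _ _ _ iB) => //; first exact/measurable_EFinP.
    move=> y _ /=; rewrite lee_fin; apply: (le_trans _ (ler_norm _)).
    rewrite (normrM (v x * v y)) (normrM (v x)) mulrAC; apply: ler_wpM2r => //; apply: ler_wpM2l => //.
    apply: (le_trans (kernel_le th x y L0)).
    have ckL z : cauchy_kernel L z <= L.
      by apply: ler_piMr; [exact: ltW|exact: oneDsqrV_le1].
    by have := ckL (y - x); have := ckL (y + x); rewrite /kernel_bound; lra.
  have -> : `|\int[mu]_y (v x * v y * kernel L th x y)|%:E =
     `|\int[mu]_y (v x * v y * kernel L th x y)%:E|%E.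
    by apply: EFin_normr_Rintegral.
  apply: (le_trans (le_abse_integral _ _ _)) => //; first exact/measurable_EFinP.
  apply: ge0_le_integral => //.
  - by apply: measurableT_comp => //; exact/measurable_EFinP.
  - apply/measurable_EFinP; apply: measurable_funD.
      exact: (jointly_measurable_row _ mA).
    exact: (jointly_measurable_row _ mA').
  move=> y _; rewrite /= lee_fin /A (kbC y) -mulrDl (normrM (v x * v y)).
  apply: ler_pM => //; last exact: kernel_le.
  rewrite -mulrDr (normrM (v x)) -(real_normK (num_real (v x))) -(real_normK (num_real (v y))).
  rewrite -subr_ge0; have -> : 2^-1 * (`|v x| ^+ 2 + `|v y| ^+ 2) - `|v x| * `|v y| =
    2^-1 * (`|v x| - `|v y|) ^+ 2 by field.
  by rewrite mulr_ge0 ?invr_ge0 ?sqr_ge0.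
have mFA : measurable_fun setT (fun x : R => \int[mu]_y (A x y)%:E)%E.
  have := @measurable_fun_fubini_tonelli_F _ _ _ _ R mu (fun z : R * R => (A z.1 z.2)%:E).
  by apply => /= [|z]; [exact/measurable_EFinP|rewrite lee_fin].
have mFA' : measurable_fun setT (fun x : R => \int[mu]_y (A y x)%:E)%E.
  have := @measurable_fun_fubini_tonelli_F _ _ _ _ R mu (fun z : R * R => (A z.2 z.1)%:E).
  by apply => /= [|z]; [exact/measurable_EFinP|rewrite lee_fin].
have -> : (\int[mu]_x (\int[mu]_y (A x y + A y x)%:E))%E =
   (\int[mu]_x (\int[mu]_y (A x y)%:E) + \int[mu]_x (\int[mu]_y (A y x)%:E))%E.
  rewrite -ge0_integralD //; last 2 first.
  - by move=> x _; apply: integral_ge0 => y _; rewrite lee_fin.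
  - by move=> x _; apply: integral_ge0 => y _; rewrite lee_fin.
  apply: eq_integral => x _.
  under eq_integral do rewrite EFinD.
  rewrite ge0_integralD //.
  - by move=> y _; rewrite lee_fin.
  - by apply/measurable_EFinP; exact: (jointly_measurable_row _ mA).
  - by move=> y _; rewrite lee_fin.
  - by apply/measurable_EFinP; exact: (jointly_measurable_row _ mA').
have -> : (\int[mu]_x (\int[mu]_y (A y x)%:E) = \int[mu]_x (\int[mu]_y (A x y)%:E))%E.
  have := @fubini_tonelli _ _ _ _ R mu mu (fun z : R * R => (A z.1 z.2)%:E).
  by move=> /= ->; [|exact/measurable_EFinP|move=> z; rewrite lee_fin].
apply: (le_trans (leeD IA IA)).
by rewrite -EFinD lee_fin; apply: eq_ler; ring.
Qed.

Lemma wave_bessel th (v : R -> R) (a b : R) : rapid v -> a <= b ->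
  \int[mu]_(x in `[a, b]) (wave th v x ^+ 2) <= 12 * pi * \int[mu]_x v x ^+ 2.
Proof.
(* With this [L] the triangle is at least [1/2] on [[a, b]]; removing it doubles the constant. *)
move=> rv ab; pose L := 2 * (`|a| + `|b| + 1).
have L0 : 0 < L by rewrite mulr_gt0 // ltr_wpDl // addr_ge0.
have rwS := rapid_tri_wave th L0 rv; have [B HB] := @wave_bounded th v rv.
have cS := @continuous_wave th v rv.
have cS2 : continuous (fun x => wave th v x ^+ 2) by move=> x; apply: cvgM; exact: cS.
have rS2 : rapid (fun x => tri L x * wave th v x ^+ 2).
  apply: (@rapid_triM _ L0 _ (B ^+ 2)) => // x.
  by rewrite normrX; apply: lerXn2r; rewrite ?nnegrE // (le_trans _ (HB 0)).
apply: (@le_trans _ _ (2 * \int[mu]_x (tri L x * wave th v x ^+ 2))); last first.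
  by have := weighted_bessel th L0 rv; lra.
rewrite -RintegralZl //; last exact: rapid_integrable.
have i2 : mu.-integrable setT (EFin \o (fun x => 2 * (tri L x * wave th v x ^+ 2))).
  by apply: integrable_scale => //; exact: rapid_integrable.
apply: (@le_trans _ _ (\int[mu]_(x in `[a, b]) (2 * (tri L x * wave th v x ^+ 2)))).
  apply: le_Rintegral => //.
  - exact: continuous_integrable_itv.
  - exact: integrableS i2.
  move=> x; rewrite /= in_itv /= => /andP[ax xb].
  have : 2^-1 <= tri L x.
    apply: tri_half => //; rewrite /L mulrC mulKf // ler_norml.
    have := ler_norm b; have := ler_norm (- a); rewrite normrN.
    have := normr_ge0 a; have := normr_ge0 b; lra.
  move=> h; rewrite mulrA -[leLHS]mul1r ler_wpM2r ?sqr_ge0 //; lra.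
rewrite /Rintegral -lee_fin !fineK; [|exact: integrable_fin_num|].
  apply: ge0_subset_integral => //.
  - exact: (measurable_int mu).
  - move=> x _; rewrite lee_fin; apply: mulr_ge0 => //.
    by apply: mulr_ge0; [exact: tri_ge0|exact: sqr_ge0].
by apply: integrable_fin_num => //; exact: integrableS i2.
Qed.

End Bessel.

(** * Oscillatory integrals of Fourier transforms *)

Section FullLine.
Context {R : realType}.
Local Open Scope classical_set_scope.
Local Open Scope ring_scope.
Local Notation mu := (@lebesgue_measure R).

Definition energy_le (N : R) (v dv : R -> R) :=
  [/\ rapid v, rapid dv, forall x : R, is_derive x 1 v (dv x) &
   [/\ \int[mu]_x v x ^+ 2 <= N ^+ 2, \int[mu]_x dv x ^+ 2 <= N ^+ 2 &
       \int[mu]_x (x * dv x) ^+ 2 <= N ^+ 2]].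

Lemma mul_wave th (v dv : R -> R) xi : rapid v -> rapid dv ->
  (forall x : R, is_derive x 1 v (dv x)) ->
  xi * wave th v xi = - wave (th - pi / 2) dv xi.
Proof.
by move=> rv rdv Hv; rewrite -(wave_by_parts _ _ rv rdv Hv) subrK.
Qed.

(** Since [pi <= 4], Bessel's constant [12 * pi] is at most 48. The third energy is a sum of two
    transforms squared, hence at most [2 * (48 + 48) * N ^+ 2], which is below [(16 * N) ^+ 2]. *)
Lemma wave_control (N : R) th (v dv : R -> R) : 0 < N -> energy_le N v dv ->
  exists P1 P2 P3 : R -> R,
  [/\ [/\ forall x : R, is_derive x 1 P1 (wave th v x ^+ 2),
      forall x : R, is_derive x 1 P2 ((x * wave th v x) ^+ 2) &
      forall x : R, is_derive x 1 P3 ((x * wave (th + pi / 2) (fun y => y * v y) x) ^+ 2)],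
      forall a b : R, 0 <= a -> a <= b -> P1 b - P1 a <= (16 * N) ^+ 2,
      forall a b : R, 0 <= a -> a <= b -> P2 b - P2 a <= (16 * N) ^+ 2 &
      forall a b : R, 0 <= a -> a <= b -> P3 b - P3 a <= (16 * N) ^+ 2].
Proof.
move=> N0 [rv rdv Hv [Ev Edv Exdv]].
have pi4 : (pi : R) <= 4 by have := @pihalf_lt2 R; lra.
have pi0 : (0 : R) <= pi := pi_ge0 R.
have bd (I : R) : I <= N ^+ 2 -> 12 * pi * I <= 48 * N ^+ 2.
  move=> IN; apply: (@le_trans _ _ (12 * pi * N ^+ 2)).
    by rewrite ler_wpM2l // mulr_ge0.
  by rewrite ler_wpM2r ?sqr_ge0 //; lra.
have N2 : 0 <= N ^+ 2 by exact: sqr_ge0.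
have cw (th' : R) (u : R -> R) : rapid u -> continuous (wave th' u) by move=> ru; exact: continuous_wave.
have cw2 (th' : R) (u : R -> R) : rapid u -> continuous (fun x => wave th' u x ^+ 2).
  by move=> ru x; apply: cvgM; exact: cw.
have rxv := rapidX rv; have rxdv := rapidX rdv.
have [P1 [HP1 EP1]] := continuous_primitive (cw2 th v rv).
have [P2 [HP2 EP2]] := continuous_primitive (cw2 (th - pi / 2) dv rdv).
have c3 : continuous (fun x : R => (x * wave (th + pi / 2) (fun y => y * v y) x) ^+ 2).
  move=> x; apply: cvgM; apply: cvgM; try exact: cvg_id; exact: cw.
have [P3 [HP3 EP3]] := continuous_primitive c3.
exists P1, P2, P3; split; [split=> // x|..].
- by rewrite (mul_wave _ _ rv rdv Hv) sqrrN.
- move=> a b _ ab; rewrite EP1 //; apply: (le_trans (wave_bessel th rv ab)).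
  by have := bd _ Ev; rewrite exprMn; lra.
- move=> a b _ ab; rewrite EP2 //; apply: (le_trans (wave_bessel (th - pi / 2) rdv ab)).
  by have := bd _ Edv; rewrite exprMn; lra.
move=> a b _ ab; rewrite EP3 //.
have i1 := continuous_integrable_itv a b (cw2 th _ rxdv).
have i2 := continuous_integrable_itv a b (cw2 th _ rv).
have j1 := integrable_scale 2 (measurable_itv _) i1.
have j2 := integrable_scale 2 (measurable_itv _) i2.
have := wave_bessel th rxdv ab; have := wave_bessel th rv ab.
have := bd _ Exdv; have := bd _ Ev => b1 b2 b3 b4.
apply: (@le_trans _ _ (\int[mu]_(x in `[a, b])
   (2 * wave th (fun y => y * dv y) x ^+ 2 + 2 * wave th v x ^+ 2))).
  apply: le_Rintegral.
  - exact: measurable_itv.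
  - exact: continuous_integrable_itv c3.
  - by apply: integrable_add.
  move=> x _; rewrite (wave_by_parts_der _ _ rv rdv Hv).
  rewrite -subr_ge0; set A := wave _ _ _; set B := wave _ _ _.
  have -> : 2 * A ^+ 2 + 2 * B ^+ 2 - (- A - B) ^+ 2 = (A - B) ^+ 2 by ring.
  exact: sqr_ge0.
rewrite RintegralD // !RintegralZl //.
rewrite exprMn; lra.
Qed.

(** A bound by absolute values, cut at 1, for an arbitrary [psi]. It serves for short times and,
    with a phase encoding signs, for integrability of the transform. *)
Lemma half_line_le (N : R) th (v dv : R -> R) (H psi : R -> R) (b : R) : 0 < N ->
  energy_le N v dv ->
  (forall y : R, is_derive y 1 H (cos (psi y) * wave th v y)) -> 0 <= b ->
  `|H b - H 0| <= 32 * N.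
Proof.
move=> N0 ev HH b0; have [P1 [P2 [P3 [[HP1 HP2 HP3] I1 I2 I3]]]] := wave_control th N0 ev.
have N16 : 0 < 16 * N by rewrite mulr_gt0.
have near0 c : 0 <= c -> c <= 1 -> `|H c - H 0| <= 16 * N.
  move=> c0 c1; rewrite -[leRHS]mulr1.
  by apply: (increment_near0 N16 HP1 I1 HH); rewrite // expr1n.
have [b1|/ltW b1] := leP b 1.
  by apply: (le_trans (near0 _ b0 b1)); move: N0; lra.
have := near0 _ ler01 (lexx _).
have := increment_tail N16 HP2 I2 HH ltr01 _ b1; rewrite expr1n divr1 => /(_ (lexx _)).
have -> : H b - H 0 = (H b - H 1) + (H 1 - H 0) by ring.
move=> h1 h2; apply: (le_trans (ler_normD _ _)); lra.
Qed.

Lemma tanhN (x : R) : tanh (- x) = - tanh x.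
Proof. by rewrite /tanh opprK -mulNr opprB [expR (- x) + expR x]addrC. Qed.

Lemma dispN (x : R) : disp (- x) = disp x.
Proof. by rewrite /disp tanhN mulrNN. Qed.

Lemma continuous_disp : continuous (@disp R).
Proof.
move=> x; apply: (@continuous_comp _ _ _ (fun x : R => x * tanh x)).
  by apply: cvgM; [exact: cvg_id|exact: continuous_of_der (@der_tanh R) x].
exact: sqrt_continuous.
Qed.

Lemma waveN th (v : R -> R) (xi : R) : wave th v (- xi) = wave (- th) v xi.
Proof.
by apply: eq_Rintegral => x _; rewrite -cosN; congr (cos _ * _); ring.
Qed.

Definition phase (x th e n xi : R) : R := x * xi + e ^+ 8 * disp (n ^+ 2 * xi) + th.

Lemma continuous_phase x th e n : continuous (phase x th e n).
Proof.
move=> xi; apply: cvgD; last exact: cvg_cst.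
apply: cvgD; first by apply: cvgM; [exact: cvg_cst|exact: cvg_id].
apply: cvgM; first exact: cvg_cst.
apply: (@continuous_comp _ _ _ (fun xi : R => n ^+ 2 * xi)); last exact: continuous_disp.
by apply: cvgM; [exact: cvg_cst|exact: cvg_id].
Qed.

Lemma phaseN x th e n xi : phase x th e n (- xi) = phase (- x) th e n xi.
Proof. by rewrite /phase !mulrN dispN mulNr. Qed.

(** Carries the negative half-line to the positive one; on the integrands this negates [x] and the
    shift of [wave]. *)
Lemma der_reflect (H h : R -> R) : (forall y : R, is_derive y 1 H (h y)) ->
  forall y : R, is_derive y 1 (fun y => - H (- y)) (h (- y)).
Proof.
move=> HH y; have H1 := HH (- y).
have HN : is_derive y 1 (fun y : R => - y) (- 1) by der.
have Hc := @der_comp _ H (fun y => - y) y _ _ H1 HN.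
by der; rewrite mulrN1 opprK.
Qed.

Lemma integrable_wave_transform (N : R) th (v dv : R -> R) : 0 < N ->
  energy_le N v dv -> mu.-integrable setT (EFin \o wave th v).
Proof.
move=> N0 ev; have [rv _ _ _] := ev; have cw := @continuous_wave _ th v rv.
apply: (@integrable_of_bounded _ _ (64 * N)) => // b b0.
have cnw : continuous (fun x => `|wave th v x|) by move=> x; apply: cvg_norm; exact: cw.
have [F [HF FE]] := continuous_primitive cnw.
(* A phase with values 0 and [pi] turns [cos (psi y) * w y] into [|w y|]. *)
pose psi (w : R -> R) (y : R) : R := if 0 <= w y then 0 else pi.
have psiE (w : R -> R) y : cos (psi w y) * w y = `|w y|.
  rewrite /psi; case: leP => w0; first by rewrite cos0 mul1r ger0_norm.
  by rewrite cospi mulN1r ltr0_norm.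
rewrite -FE ?ge0_cp //.
have h1 : `|F b - F 0| <= 32 * N.
  apply: (@half_line_le _ th v dv F (psi (wave th v))) => // y.
  by rewrite psiE; exact: HF.
have h2 : `|(- F (- b)) - (- F (- 0))| <= 32 * N.
  apply: (@half_line_le _ (- th) v dv (fun y => - F (- y)) (psi (wave (- th) v))) => // y.
  by rewrite psiE -waveN; exact: (der_reflect HF).
have -> : F b - F (- b) = (F b - F 0) + ((- F (- b)) - (- F (- 0))).
  by rewrite oppr0; ring.
apply: (le_trans (ler_norm _)); apply: (le_trans (ler_normD _ _)); lra.
Qed.

Lemma integrable_oscillatory (N : R) th (v dv : R -> R) x th' e n : 0 < N ->
  energy_le N v dv ->
  mu.-integrable setT (EFin \o (fun xi => cos (phase x th' e n xi) * wave th v xi)).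
Proof.
move=> N0 ev; have [rv _ _ _] := ev; have cw := @continuous_wave _ th v rv.
apply: (le_integrable _ _ _ (integrable_wave_transform th N0 ev)) => //.
  apply/measurable_EFinP; apply: continuous_measurable_fun => y.
  apply: cvgM; last exact: cw.
  by apply: (@continuous_comp _ _ _ (phase x th' e n));
    [exact: continuous_phase|exact: continuous_cos].
by move=> y _ /=; rewrite lee_fin norm_cosM_le.
Qed.

(** The first bound is for short times, the second for [e >= 1]. Two half-lines give [64 * N] for
    the former and [2 * 16 * C0] for the latter. *)
Lemma oscillatory_integral : exists2 C : R, 0 < C &
  forall (N : R) th (v dv : R -> R) x th' e n, 0 < N -> energy_le N v dv ->
  0 < e -> 0 < n ->
  `|\int[mu]_xi (cos (phase x th' e n xi) * wave th v xi)| <= C * N /\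
  (1 <= e -> `|\int[mu]_xi (cos (phase x th' e n xi) * wave th v xi)| <=
    C * (N * ((n * e)^-1 + e ^- 4))).
Proof.
have [c c0 [csmall clarge]] := @disp2_bounds R.
pose C0 := 10 + 738 / c; have C00 : 0 < C0.
  by apply: addr_gt0; [rewrite ltr0n|apply: divr_gt0; [rewrite ltr0n|]].
exists (64 + 32 * C0); first by apply: addr_gt0; [rewrite ltr0n|exact: mulr_gt0].
move=> N th v dv x th' e n N0 ev e0 n0.
have [rv _ _ _] := ev; have cw := @continuous_wave _ th v rv.
have Ig := integrable_oscillatory th x th' e n N0 ev.
pose g xi := cos (phase x th' e n xi) * wave th v xi.
have cg : continuous g.
  move=> y; apply: cvgM; last exact: cw.
  by apply: (@continuous_comp _ _ _ (phase x th' e n));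
    [exact: continuous_phase|exact: continuous_cos].
have [F [HF FE]] := continuous_primitive cg.
have HF' (y : R) : is_derive y 1 (fun y => - F (- y))
    (cos (phase (- x) th' e n y) * wave (- th) v y).
  by have := der_reflect HF y; rewrite /g phaseN waveN.
have split b : 0 <= b -> \int[mu]_(xi in `[- b, b]) g xi =
    (F b - F 0) + ((- F (- b)) - (- F (- 0))).
  by move=> b0; rewrite -FE ?ge0_cp // oppr0; ring.
have CN0 : 0 <= C0 * N by rewrite mulr_ge0 // ltW.
split=> [|e1].
  apply: (@Rintegral_norm_le _ _ _ 0) => // b b0; rewrite split //.
  have h1 := half_line_le N0 ev HF b0; have h2 := half_line_le N0 ev HF' b0.
  apply: (le_trans (ler_normD _ _)); rewrite mulrDl -mulrA.
  move: CN0 h1 h2; lra.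
have X0 : 0 <= N * ((n * e)^-1 + e ^- 4).
  apply: mulr_ge0; first exact: ltW.
  by rewrite addr_ge0 // invr_ge0 ?exprn_ge0 ?mulr_ge0 // ltW.
have N16 : 0 < 16 * N by rewrite mulr_gt0.
apply: (@Rintegral_norm_le _ _ _ (n ^- 2 + e ^+ 8)) => // b bA.
have n2 : 0 <= n ^- 2 by rewrite invr_ge0 exprn_ge0 // ltW.
have e8 : 0 <= e ^+ 8 by rewrite exprn_ge0 // ltW.
have nb : n ^- 2 <= b by apply: le_trans bA; rewrite lerDl.
have eb : e ^+ 8 <= b by apply: le_trans bA; rewrite lerDr.
rewrite split; last exact: le_trans nb.
have half th1 x1 G : (forall y : R, is_derive y 1 G
    (cos (phase x1 th' e n y) * wave th1 v y)) ->
    `|G b - G 0| <= C0 * (16 * N * ((n * e)^-1 + e ^- 4)).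
  move=> HG; have [P1 [P2 [P3 [[HP1 HP2 HP3] I1 I2 I3]]]] := wave_control th1 N0 ev.
  exact: (oscillatory_increment N16 (fun xi => der_wave th1 xi rv) HP1 HP2 HP3
    I1 I2 I3 c0 csmall clarge e1 n0 HG nb eb).
have h1 := half _ _ _ HF; have h2 := half _ _ _ HF'.
apply: (le_trans (ler_normD _ _)).
apply: (le_trans (lerD h1 h2)); rewrite -subr_ge0.
have -> : (64 + 32 * C0) * (N * ((n * e)^-1 + e ^- 4)) -
  (C0 * (16 * N * ((n * e)^-1 + e ^- 4)) + C0 * (16 * N * ((n * e)^-1 + e ^- 4))) =
  64 * (N * ((n * e)^-1 + e ^- 4)) by ring.
by rewrite mulr_ge0.
Qed.

End FullLine.

(** * Schwartz functions and norms *)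

Section Schwartz.
Context {R : realType}.
Local Open Scope classical_set_scope.
Local Open Scope ring_scope.
Local Notation mu := (@lebesgue_measure R).

Lemma cmodE (z : R[i]) : cmod z = Num.sqrt (complex.Re z ^+ 2 + complex.Im z ^+ 2).
Proof. by case: z. Qed.

Lemma norm_Re_le (z : R[i]) : `|complex.Re z| <= cmod z.
Proof. by rewrite cmodE -sqrtr_sqr ler_wsqrtr // lerDl sqr_ge0. Qed.

Lemma norm_Im_le (z : R[i]) : `|complex.Im z| <= cmod z.
Proof. by rewrite cmodE -sqrtr_sqr ler_wsqrtr // lerDr sqr_ge0. Qed.

Lemma cmod_le (z : R[i]) : cmod z <= `|complex.Re z| + `|complex.Im z|.
Proof.
rewrite cmodE -[leRHS]ger0_norm ?addr_ge0 // -sqrtr_sqr ler_wsqrtr // sqrrD.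
rewrite !real_normK ?num_real // addrAC lerDl mulrn_wge0 // mulr_ge0 //.
Qed.

(* [pr] is meant to be the real or the imaginary part. *)
Definition component (pr : R[i] -> R) :=
  [/\ forall z, `|pr z| <= cmod z,
      forall (f : R -> R[i]) (x : R), cderivable f x ->
        is_derive x 1 (fun y => pr (f y)) (pr (cderive f x)) &
      forall (r : R) z, pr (r%:C * z) = r * pr z].

Lemma component_Re : component (@complex.Re R).
Proof.
split=> [z|f x [dr _]|r [a b]]; first exact: norm_Re_le.
  by apply: DeriveDef => //; rewrite /cderive /= derive1E.
by rewrite /= mul0r subr0.
Qed.

Lemma component_Im : component (@complex.Im R).
Proof.
split=> [z|f x [_ di]|r [a b]]; first exact: norm_Im_le.
  by apply: DeriveDef => //; rewrite /cderive /= derive1E.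
by rewrite /= mul0r addr0.
Qed.

Lemma schwartz_rapid (pr : R[i] -> R) (phi : R -> R[i]) k : component pr ->
  schwartz phi -> rapid (fun x => pr (cderiven k phi x)).
Proof.
move=> [prle prd _] [dphi sphi]; split.
  exact: (continuous_of_der (fun x => prd _ _ (dphi k x))).
move=> j; have [M1 H1] := sphi j k; have [M2 H2] := sphi j.+2 k.
exists (M1 + M2) => x; rewrite ler_pdivlMr ?oneDsqr_gt0 // normrM normrX.
apply: (@le_trans _ _ (`|x| ^+ j * cmod (cderiven k phi x) * oneDsqr x)).
  by rewrite ler_wpM2r ?oneDsqr_ge0 // ler_wpM2l ?exprn_ge0.
rewrite /oneDsqr mulrDr mulr1; apply: lerD => //; apply: le_trans (H2 x).
by rewrite -[x ^+ 2](real_normK (num_real x)) mulrAC -exprD addn2.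
Qed.

Lemma Lnorm2_component (pr : R[i] -> R) (f : R -> R[i]) (N : R) : component pr ->
  rapid (fun x => pr (f x)) ->
  continuous (fun x => complex.Re (f x)) -> continuous (fun x => complex.Im (f x)) ->
  0 <= N -> (cLnorm 2%:E f <= N%:E)%E -> \int[mu]_x pr (f x) ^+ 2 <= N ^+ 2.
Proof.
move=> [prle _ _] rf cr ci N0 fN.
have mf : measurable_fun setT (fun x => cmod (f x)).
  apply: continuous_measurable_fun => x.
  rewrite (_ : (fun x => cmod (f x)) =
    (fun x => Num.sqrt (complex.Re (f x) ^+ 2 + complex.Im (f x) ^+ 2))); last first.
    by apply/funext => y; rewrite cmodE.
  apply: (@continuous_comp _ _ _ (fun x => complex.Re (f x) ^+ 2 + complex.Im (f x) ^+ 2)).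
    by apply: cvgD; apply: cvgM; [exact: cr|exact: cr|exact: ci|exact: ci].
  exact: sqrt_continuous.
have E : (\int[mu]_x (`|(cmod (f x))%:E| `^ 2) <= (N ^+ 2)%:E)%E.
  have := @poweR_Lnorm _ _ R mu (fun x => (cmod (f x))%:E) 2.
  rewrite -/(cLnorm 2%:E f) => <-; last by rewrite pnatr_eq0.
  have -> : ((N ^+ 2)%:E = N%:E `^ 2)%E by rewrite poweR_EFin powR_mulrn.
  apply: gt0_ler_poweR => //; rewrite in_itv /= ?leey ?andbT ?lee_fin //.
  exact: Lnorm_ge0.
have rf2 := rapid_sqr rf.
rewrite -lee_fin /Rintegral fineK; last first.
  by apply: integrable_fin_num => //; exact: rapid_integrable.
apply: le_trans E; apply: ge0_le_integral => //.
- by move=> x _; rewrite lee_fin sqr_ge0.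
- by apply/measurable_EFinP; exact: rapid_measurable.
- apply/measurable_EFinP; apply: (@measurableT_comp _ _ _ _ _ _ (fun x : R => x `^ 2)) => //.
  exact: measurableT_comp.
move=> x _; rewrite /= lee_fin powR_mulrn //.
rewrite -(real_normK (num_real (pr (f x)))); apply: lerXn2r; rewrite ?nnegrE //.
exact: le_trans (prle _) (ler_norm _).
Qed.

Lemma schwartz_energy (pr : R[i] -> R) (phi : R -> R[i]) (N : R) : component pr ->
  schwartz phi -> 0 <= N -> (cLnorm 2%:E phi <= N%:E)%E ->
  (cLnorm 2%:E (cderive phi) <= N%:E)%E ->
  (cLnorm 2%:E (fun x : R => (x%:C * cderive phi x)%R) <= N%:E)%E ->
  energy_le N (fun x => pr (phi x)) (fun x => pr (cderive phi x)).
Proof.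
move=> cpr sphi N0 n1 n2 n3; have [prle prd prZ] := cpr.
have [dphi _] := sphi.
have r0 := schwartz_rapid 0 cpr sphi; have r1 := schwartz_rapid 1 cpr sphi.
have [cr0 _] := schwartz_rapid 0 component_Re sphi.
have [ci0 _] := schwartz_rapid 0 component_Im sphi.
have [cr1 _] := rapidX (schwartz_rapid 1 component_Re sphi).
have [ci1 _] := rapidX (schwartz_rapid 1 component_Im sphi).
have [cr1' _] := schwartz_rapid 1 component_Re sphi.
have [ci1' _] := schwartz_rapid 1 component_Im sphi.
split => //; first by move=> x; exact: (prd _ _ (dphi 0 x)).
split.
- exact: (Lnorm2_component cpr r0).
- exact: (Lnorm2_component cpr r1).
have [_ _ ReZ] := component_Re; have [_ _ ImZ] := component_Im.
have := @Lnorm2_component pr (fun x : R => x%:C * cderive phi x) N cpr.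
rewrite (_ : (fun x : R => pr (x%:C * cderive phi x)) = (fun x => x * pr (cderive phi x)));
  last by apply/funext => x.
rewrite (_ : (fun x : R => complex.Re (x%:C * cderive phi x)) =
  (fun x => x * complex.Re (cderive phi x))); last by apply/funext => x; rewrite ReZ.
rewrite (_ : (fun x : R => complex.Im (x%:C * cderive phi x)) =
  (fun x => x * complex.Im (cderive phi x))); last by apply/funext => x; rewrite ImZ.
move=> /(_ (rapidX r1) cr1 ci1 N0 n3) h; apply: le_trans h.
by apply: eq_ler; apply: eq_Rintegral => x _; rewrite prZ.
Qed.

Lemma cLnorm_le_H1norm (phi : R -> R[i]) :
  (cLnorm 2%:E phi <= H1norm phi)%E /\ (cLnorm 2%:E (cderive phi) <= H1norm phi)%E.
Proof.
have sq (a b : \bar R) : (0 <= a -> 0 <= b -> a <= (a ^+ 2 + b ^+ 2) `^ 2^-1)%E.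
  move=> a0 b0; have b2 : (0 <= b ^+ 2)%E by rewrite expe2 mule_ge0.
  have a2 : (0 <= a ^+ 2)%E by rewrite expe2 mule_ge0.
  apply: (@le_trans _ _ ((a ^+ 2) `^ 2^-1)%E).
    case: a a0 a2 => [a| |] // a0 _; last by rewrite expe2 mulyy eqy_poweR // invr_gt0.
    by rewrite -EFin_expe poweR_EFin lee_fin powR12_sqrt ?sqr_ge0 // sqrtr_sqr ler_norm.
  apply: gt0_ler_poweR; rewrite ?invr_ge0 ?in_itv /= ?leey ?andbT ?adde_ge0 //.
  by rewrite leeDl.
rewrite /H1norm; split; first by apply: sq; exact: Lnorm_ge0.
by rewrite addeC; apply: sq; exact: Lnorm_ge0.
Qed.

Lemma cLnorm_pinfty_le (f : R -> R[i]) (B : \bar R) : (forall x, ((cmod (f x))%:E <= B)%E) ->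
  (0 <= B)%E -> (cLnorm +oo f <= B)%E.
Proof.
move=> fB B0; rewrite /cLnorm unlock /Lnorm; case: ifPn => // _.
apply/ess_supP; apply/nearW => x /=.
rewrite ger0_norm //; exact: le_trans (normr_ge0 _) (norm_Re_le _).
Qed.

End Schwartz.

(** * The propagator *)

Section Propagator.
Context {R : realType}.
Local Open Scope classical_set_scope.
Local Open Scope ring_scope.
Local Notation mu := (@lebesgue_measure R).

(** Integrability travels with the bound because additivity of the integral requires it. *)
Definition integral_bounded (B : R) (f : R -> R) :=
  mu.-integrable setT (EFin \o f) /\ `|\int[mu]_x f x| <= B.

Lemma integral_boundedD (A B : R) (f g : R -> R) : integral_bounded A f ->
  integral_bounded B g -> integral_bounded (A + B) (fun x => f x + g x).
Proof.
move=> [fi fA] [gi gB]; split; first exact: integrable_add.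
by rewrite RintegralD // (le_trans (ler_normD _ _)) // lerD.
Qed.

Lemma integral_boundedN (B : R) (f : R -> R) : integral_bounded B f ->
  integral_bounded B (fun x => - f x).
Proof.
move=> [fi fB]; rewrite (_ : (fun x => - f x) = (fun x => -1 * f x)); last first.
  by apply/funext => x; rewrite mulN1r.
split; first exact: integrable_scale.
by rewrite RintegralZl // mulN1r normrN.
Qed.

Lemma fourierE (phi : R -> R[i]) (xi : R) : schwartz phi ->
  complex.Re (fourier phi xi) = wave 0 (fun x => complex.Re (phi x)) xi +
    wave (- (pi / 2)) (fun x => complex.Im (phi x)) xi /\
  complex.Im (fourier phi xi) = wave 0 (fun x => complex.Im (phi x)) xi -
    wave (- (pi / 2)) (fun x => complex.Re (phi x)) xi.
Proof.
move=> sphi; have r1 := schwartz_rapid 0 component_Re sphi.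
have r2 := schwartz_rapid 0 component_Im sphi.
split; rewrite /=.
  rewrite -RintegralD //; [|exact: integrable_wave|exact: integrable_wave].
  apply: eq_Rintegral => x _; rewrite addr0 cosBpihalf /cexpi cosN sinN.
  by case: (phi x) => a b /=; ring.
rewrite -RintegralB //; [|exact: integrable_wave|exact: integrable_wave].
apply: eq_Rintegral => x _; rewrite addr0 cosBpihalf /cexpi cosN sinN.
by case: (phi x) => a b /=; ring.
Qed.

Lemma omega_phase (m t x e n xi : R) : 0 < m -> n ^+ 2 = Num.sqrt m ->
  e ^+ 8 = t / Num.sqrt m -> x * xi + t * omega m xi = phase x 0 e n xi.
Proof.
move=> m0 nm es; have s0 : 0 < Num.sqrt m by rewrite sqrtr_gt0.
rewrite /phase nm es addr0; congr (_ + _); rewrite -mulrA; congr (_ * _).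
rewrite /omega /disp.
have E : `|xi| * tanh (Num.sqrt m * `|xi|) = xi * tanh (Num.sqrt m * xi).
  have [x0|x0] := leP 0 xi; first by rewrite ger0_norm.
  by rewrite ltr0_norm // mulrN tanhN mulrNN.
rewrite E; have -> : xi * tanh (Num.sqrt m * xi) / Num.sqrt m =
   (Num.sqrt m)^-1 ^+ 2 * (Num.sqrt m * xi * tanh (Num.sqrt m * xi)).
  by field; rewrite lt0r_neq0.
rewrite sqrtrM ?sqr_ge0 // sqrtr_sqr ger0_norm // invr_ge0; exact: ltW.
Qed.

(** The real and the imaginary part of the inverse transform each expand into four integrals of the
    given form, whence [8 * B]; the prefactor [(2 * pi)^-1] is bounded by 1. *)
Lemma propagator_le (m t e n B x : R) (phi : R -> R[i]) : 0 < m ->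
  n ^+ 2 = Num.sqrt m -> e ^+ 8 = t / Num.sqrt m -> schwartz phi ->
  (forall th th', integral_bounded B (fun xi =>
     cos (phase x th' e n xi) * wave th (fun x => complex.Re (phi x)) xi)) ->
  (forall th th', integral_bounded B (fun xi =>
     cos (phase x th' e n xi) * wave th (fun x => complex.Im (phi x)) xi)) ->
  cmod (propagator t (omega m) phi x) <= 8 * B.
Proof.
move=> m0 nm es sphi BR BI.
have B0 : 0 <= B by have [_] := BR 0 0; exact: le_trans.
set v1 := (fun x => complex.Re (phi x)) in BR *.
set v2 := (fun x => complex.Im (phi x)) in BI *.
pose h xi := cexpi (x * xi) * (cexpi (t * omega m xi) * fourier phi xi).
have ph xi : cos (x * xi + t * omega m xi) = cos (phase x 0 e n xi) /\
     sin (x * xi + t * omega m xi) = - cos (phase x (pi / 2) e n xi).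
  rewrite (omega_phase x xi m0 nm es); split => //.
  have -> : phase x (pi / 2) e n xi = phase x 0 e n xi + pi / 2 by rewrite /phase; ring.
  by rewrite cosDpihalf opprK.
have hE xi : complex.Re (h xi) =
    cos (x * xi + t * omega m xi) * complex.Re (fourier phi xi) -
    sin (x * xi + t * omega m xi) * complex.Im (fourier phi xi) /\
  complex.Im (h xi) =
    cos (x * xi + t * omega m xi) * complex.Im (fourier phi xi) +
    sin (x * xi + t * omega m xi) * complex.Re (fourier phi xi).
  by rewrite /h /cexpi cosD sinD; case: (fourier phi xi) => a b /=; split; ring.
have Hr : `|\int[mu]_xi complex.Re (h xi)| <= 4 * B.
  have := integral_boundedD (integral_boundedD (BR 0 0) (BI (- (pi / 2)) 0))
    (integral_boundedD (BI 0 (pi / 2)) (integral_boundedN (BR (- (pi / 2)) (pi / 2)))).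
  move=> [_]; rewrite (_ : B + B + (B + B) = 4 * B); last by ring.
  apply: le_trans; apply: eq_ler; congr (`|_|); apply: eq_Rintegral => xi _.
  have [-> _] := hE xi; have [-> ->] := ph xi; have [-> ->] := fourierE xi sphi.
  by rewrite -/v1 -/v2; ring.
have Hi : `|\int[mu]_xi complex.Im (h xi)| <= 4 * B.
  have := integral_boundedD
    (integral_boundedD (BI 0 0) (integral_boundedN (BR (- (pi / 2)) 0)))
    (integral_boundedD (integral_boundedN (BR 0 (pi / 2)))
       (integral_boundedN (BI (- (pi / 2)) (pi / 2)))).
  move=> [_]; rewrite (_ : B + B + (B + B) = 4 * B); last by ring.
  apply: le_trans; apply: eq_ler; congr (`|_|); apply: eq_Rintegral => xi _.
  have [_ ->] := hE xi; have [-> ->] := ph xi; have [-> ->] := fourierE xi sphi.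
  by rewrite -/v1 -/v2; ring.
have -> : propagator t (omega m) phi x = ((2 * pi)^-1)%:C * cintegral h by [].
have [_ _ ReZ] := @component_Re R; have [_ _ ImZ] := @component_Im R.
apply: (le_trans (cmod_le _)); rewrite ReZ ImZ !normrM -mulrDr.
have p1 : `|(2 * pi)^-1| <= (1 : R).
  have p0 := @pi_ge2 R; have pp := @pi_gt0 R.
  rewrite ger0_norm ?invr_ge0 ?mulr_ge0 ?(ltW pp) // invf_le1 ?mulr_gt0 //; lra.
rewrite -[leRHS]mul1r; apply: ler_pM; [by []|exact: addr_ge0|exact: p1|].
by rewrite /=; move: Hr Hi; lra.
Qed.

(** Compares [q = (1 + s)^(1/8)] with [e = s^(1/8)]: [q <= 2] when [e <= 1] and [q <= 2 e] when
    [e >= 1]. The fourth power of this 2 is the 16. *)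
Lemma time_factor (e n s : R) (X := 1 / n * (1 / (1 + s) `^ (1 / 8)) + 1 / (1 + s) `^ (1 / 2)) :
  0 < e -> 0 < n -> e ^+ 8 = s ->
  (e <= 1 -> 1 <= 16 * X) /\ (1 <= e -> (n * e)^-1 + e ^- 4 <= 16 * X).
Proof.
move=> e0 n0 es; have s0 : 0 < s by rewrite -es exprn_gt0.
pose q := (1 + s) `^ (1 / 8).
have s1 : 0 < 1 + s by rewrite addr_gt0.
have q0 : 0 < q by rewrite powR_gt0.
have q8 : q ^+ 8 = 1 + s.
  by rewrite -powR_mulrn ?(ltW q0) // -powRrM mul1r mulVf ?pnatr_eq0 // powRr1 // ltW.
have q4 : (1 + s) `^ (1 / 2) = q ^+ 4.
  rewrite -powR_mulrn ?(ltW q0) // -powRrM; congr (_ `^ _).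
  by field.
have -> : X = (n * q)^-1 + q ^- 4 by rewrite /X q4 -/q; field; rewrite !lt0r_neq0.
have nq0 : 0 < (n * q)^-1 by rewrite invr_gt0 mulr_gt0.
have q40 : 0 < q ^+ 4 by rewrite exprn_gt0.
have le8 (a b : R) : 0 <= a -> 0 <= b -> a ^+ 8 <= b ^+ 8 -> a <= b.
  by move=> a0 b0; rewrite ler_pXn2r // nnegrE.
split=> e1.
  have q2 : q <= 2.
    apply: le8; rewrite ?(ltW q0) // q8 -es -natrX.
    have : e ^+ 8 <= 1 by rewrite exprn_ile1 // ltW.
    by move=> h; apply: (@le_trans _ _ 2); [lra|rewrite ler_nat].
  have : 1 <= 16 * q ^- 4.
    rewrite -[16 * _]/(16 / q ^+ 4) ler_pdivlMr // mul1r (_ : 16 = 2 ^+ 4); last by rewrite -natrX.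
    by apply: lerXn2r; rewrite ?nnegrE ?(ltW q0).
  lra.
have q2 : q <= 2 * e.
  apply: le8; rewrite ?(ltW q0) ?mulr_ge0 ?(ltW e0) // q8 exprMn -es.
  have : 1 <= e ^+ 8 by rewrite exprn_ege1.
  have -> : (2 : R) ^+ 8 = 256 by rewrite -natrX.
  lra.
have h1 : (n * e)^-1 <= 2 * (n * q)^-1.
  rewrite -[2 * _]/(2 / (n * q)) ler_pdivlMr ?mulr_gt0 // mulrC ler_pdivrMr ?mulr_gt0 //.
  by rewrite mulrCA ler_pM2l.
have h2 : e ^- 4 <= 16 * q ^- 4.
  rewrite -[16 * _]/(16 / q ^+ 4) ler_pdivlMr // mulrC ler_pdivrMr ?exprn_gt0 //.
  rewrite (_ : 16 = 2 ^+ 4); last by rewrite -natrX.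
  by rewrite -exprMn; apply: lerXn2r; rewrite ?nnegrE ?mulr_ge0 ?(ltW q0) ?(ltW e0).
lra.
Qed.

End Propagator.

(** * The dispersive estimate *)

Theorem theorem1p1 (R : realType) :
  exists2 C : R, 0 < C &
    forall (mu : R), 0 < mu -> forall (t : R), 0 < t ->
    forall (phi : R -> R[i]), schwartz phi ->
    (cLnorm +oo (propagator t (omega mu) phi)
     <= (C * (1 / mu `^ (1 / 4) * (1 / (1 + t / Num.sqrt mu) `^ (1 / 8))
              + 1 / (1 + t / Num.sqrt mu) `^ (1 / 2)))%R%:E
        * (H1norm phi + cLnorm 2%:E (fun x : R => (x%:C * cderive phi x)%R)))%E.
Proof.
have [C C0 HC] := @oscillatory_integral R.
(* 128 is 8 from [propagator_le] times 16 from [time_factor]. *)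
exists (128 * C); first by rewrite mulr_gt0.
move=> mu mu0 t t0 phi sphi.
have m0 : 0 < Num.sqrt mu by rewrite sqrtr_gt0.
pose n := Num.sqrt (Num.sqrt mu); have n0 : 0 < n by rewrite sqrtr_gt0.
have nm : n ^+ 2 = Num.sqrt mu by rewrite sqr_sqrtr // ltW.
have s0 : 0 < t / Num.sqrt mu by rewrite divr_gt0.
pose e := (t / Num.sqrt mu) `^ (1 / 8); have e0 : 0 < e by rewrite powR_gt0.
have es : e ^+ 8 = t / Num.sqrt mu.
  by rewrite -powR_mulrn ?(ltW e0) // -powRrM mul1r mulVf ?pnatr_eq0 // powRr1 // ltW.
have mn : mu `^ (1 / 4) = n.
  have mE : mu = n `^ 4%:R.
    by rewrite powR_mulrn ?(ltW n0) // -[4%N]/(2 * 2)%N exprM nm sqr_sqrtr // ltW.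
  by rewrite {1}mE -powRrM mulrC mul1r mulVf ?pnatr_eq0 // powRr1 // ltW.
have [X1 X2] := time_factor e0 n0 es.
rewrite mn; set X := (X in 128 * C * X); rewrite -/X in X1 X2.
have s1 : 0 < 1 + t / Num.sqrt mu by rewrite addr_gt0.
have X0 : 0 < X.
  by apply: addr_gt0; [apply: mulr_gt0|]; apply: divr_gt0 => //; exact: powR_gt0.
have bound N : 0 < N ->
    (H1norm phi + cLnorm 2%:E (fun x : R => (x%:C * cderive phi x)%R) <= N%:E)%E ->
    forall x, cmod (propagator t (omega mu) phi x) <= 128 * C * X * N.
  move=> N0 nN x; have [h1 h2] := cLnorm_le_H1norm phi.
  have l0 f : (0 <= cLnorm 2%:E f)%E := @Lnorm_ge0 _ _ R lebesgue_measure _ _.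
  have hN : (H1norm phi <= N%:E)%E by apply: le_trans nN; rewrite leeDl.
  have xN : (cLnorm 2%:E (fun x : R => (x%:C * cderive phi x)%R) <= N%:E)%E.
    by apply: le_trans nN; rewrite leeDr // (le_trans (l0 phi)).
  have E pr (cpr : component pr) := schwartz_energy cpr sphi (ltW N0)
    (le_trans h1 hN) (le_trans h2 hN) xN.
  have -> : 128 * C * X * N = 8 * (C * (N * (16 * X))) by ring.
  have P pr (cpr : component pr) th th' : integral_bounded (C * (N * (16 * X)))
      (fun xi => cos (phase x th' e n xi) * wave th (fun x => pr (phi x)) xi).
    split; first exact: (integrable_oscillatory _ _ _ _ _ N0 (E _ cpr)).
    have [c1 c2] := HC N th _ _ x th' e n N0 (E _ cpr) e0 n0.
    have [e1|/ltW e1] := leP e 1.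
      by apply: (le_trans c1); rewrite ler_pM2l // ler_peMr ?(ltW N0) // X1.
    by apply: (le_trans (c2 e1)); rewrite ler_pM2l // ler_pM2l // X2.
  apply: (propagator_le mu0 nm es sphi) => th th'.
    exact: (P _ (@component_Re R)).
  exact: (P _ (@component_Im R)).
have [h1 _] := cLnorm_le_H1norm phi.
have l0 f : (0 <= cLnorm 2%:E f)%E := @Lnorm_ge0 _ _ R lebesgue_measure _ _.
move: bound; set W := (H1norm phi + _)%E => bound.
have W0 : (0 <= W)%E by rewrite adde_ge0 // (le_trans (l0 phi)).
have K0 : 0 < 128 * C * X by rewrite !mulr_gt0.
apply: cLnorm_pinfty_le; last by rewrite mule_ge0 // lee_fin ltW.
move=> x; case: W W0 bound => [w| |] // w0 bound; last first.
  by rewrite gt0_muley ?leey ?lte_fin.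
(* The norm [w] may be 0 while [bound] needs [N > 0], so it is applied to [w] plus an arbitrarily
   small positive amount. *)
rewrite -EFinM lee_fin; apply/ler_addgt0Pr => d d0.
have dK : 0 < d / (128 * C * X) by rewrite divr_gt0.
have -> (k : R) : 0 < k -> k * w + d = k * (w + d / k) => //.
  by move=> k0; field; rewrite lt0r_neq0.
apply: bound; last by rewrite lee_fin lerDl ltW.
by rewrite ltr_wpDl.
Qed.
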